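(* For all integers $1\le a\le b$ with $a+b=8$, the remainder $R_{(a,b)}$ has total degree at most $5$.
   Context: $G_{m,n}$ is the $m\times n$ grid graph with cells $(i,j)$, $1\le i\le m$, $1\le j\le n$, two cells adjacent when they differ by one in a single coordinate. A height function on $G_{m,n}$ is a map $h\colon G_{m,n}\to\mathbb{Z}$ with $|h(u)-h(v)|=1$ on every edge $uv$ and $h(1,1)=0$. A cell is a strict local minimum (maximum) if every neighbour has value larger (smaller) by one. The sides of $G_{m,n}$ are the top row $i=1$, bottom row $i=m$, left column $j=1$ and right column $j=n$. For $a,b\ge1$ and $m,n\ge2$, the remainder $R_{(a,b)}(m,n)$ is the number of height functions on $G_{m,n}$ with exactly $a$ strict local minima and exactly $b$ strict local maxima whose strict local minima do not all lie on a single side. With $d=a+b\ge3$ and $a\le b$, $R_{(a,b)}$ agrees with a bivariate polynomial on $\{m,n\ge 2d-1\}$, and its total degree means the total degree of that polynomial. *)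

(* Defs.v *)
From mathcomp Require Import all_boot all_order all_algebra.
From mathcomp Require Import finmap classical_sets cardinality.
From mathcomp Require Import mpoly.

Set Implicit Arguments.
Unset Strict Implicit.
Unset Printing Implicit Defensive.

Import Order.TTheory GRing.Theory Num.Theory.

Local Open Scope ring_scope.

(* Indices are shifted down by one: the cell (i, j) of the mathematical text,
   1 <= i <= m and 1 <= j <= n, is the pair (i - 1, j - 1). *)
Definition cell (m n : nat) : finType := ('I_m * 'I_n)%type.

Definition succ_or_pred (i j : nat) : bool := (i.+1 == j) || (j.+1 == i).

Definition adjacent (m n : nat) (u v : cell m n) : bool :=
  ((u.1 == v.1) && succ_or_pred u.2 v.2) ||
  ((u.2 == v.2) && succ_or_pred u.1 v.1).

Definition is_height (m n : nat) (h : {ffun cell m n -> int}) : bool :=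
  [forall u, forall v, adjacent u v ==> (`|h u - h v| == 1)] &&
  [forall u : cell m n, (u.1 == 0 :> nat) && (u.2 == 0 :> nat) ==> (h u == 0)].

Definition local_minima (m n : nat) (h : {ffun cell m n -> int}) :
    {set cell m n} :=
  [set u | [forall v, adjacent u v ==> (h v == h u + 1)]].

Definition local_maxima (m n : nat) (h : {ffun cell m n -> int}) :
    {set cell m n} :=
  [set u | [forall v, adjacent u v ==> (h v == h u - 1)]].

Definition top_row (m n : nat) : {set cell m n} :=
  [set u : cell m n | u.1 == 0 :> nat].
Definition bottom_row (m n : nat) : {set cell m n} :=
  [set u : cell m n | u.1.+1 == m :> nat].
Definition left_column (m n : nat) : {set cell m n} :=
  [set u : cell m n | u.2 == 0 :> nat].
Definition right_column (m n : nat) : {set cell m n} :=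
  [set u : cell m n | u.2.+1 == n :> nat].

Definition on_single_side (m n : nat) (A : {set cell m n}) : bool :=
  [|| A \subset top_row m n, A \subset bottom_row m n,
      A \subset left_column m n | A \subset right_column m n].

Definition remainder_height (a b m n : nat) (h : {ffun cell m n -> int}) :
    bool :=
  [&& is_height h, #|local_minima h| == a, #|local_maxima h| == b
    & ~~ on_single_side (local_minima h)].

Lemma height_bound m n (h : {ffun cell m n -> int}) (u : cell m n) :
  is_height h -> `|h u| <= (u.1 + u.2)%:Z.
Proof.
move=> /andP[/forallP hadj /forallP h0].
have step v w k : `|h v| <= k%:Z -> adjacent v w -> `|h w| <= k.+1%:Z.
  move=> hv vw; have /eqP hvw := implyP (forallP (hadj v) w) vw.
  rewrite -[h w](subrK (h v)) (le_trans (ler_normD _ _)) // distrC hvw.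
  by rewrite -addn1 PoszD addrC lerD2r.
case: u => [[i im] [j jn]] /=.
elim: i im => [|i IHi] im.
  elim: j jn => [|j IHj] jn.
    by rewrite (eqP (implyP (h0 _) _)) ?normr0.
  apply: step (IHj (ltnW jn)) _.
  by rewrite /adjacent /succ_or_pred /= !eqxx.
rewrite addSn; apply: step (IHi (ltnW im)) _.
by rewrite /adjacent /succ_or_pred /= !eqxx orbT.
Qed.

Lemma finite_remainder_height a b m n :
  finite_set [set h | @remainder_height a b m n h]%classic.
Proof.
pose F (g : {ffun cell m n -> 'I_(m + n + (m + n)).+1}) : {ffun cell m n -> int} :=
  [ffun u => (g u : nat)%:Z - (m + n)%:Z].
apply: (@sub_finite_set _ _ (F @` setT)%classic); last first.
  by apply: finite_image; apply: finite_finset.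
move=> h /= /and4P[hh _ _ _].
exists [ffun u => inord (absz (h u + (m + n)%:Z))] => //.
apply/ffunP => u; rewrite !ffunE.
have hu : `|h u| <= (m + n)%:Z.
  rewrite (le_trans (height_bound u hh)) // lez_nat.
  by rewrite leq_add // ltnW.
move: hu; rewrite ler_norml => /andP[lo hi].
have nn : 0 <= h u + (m + n)%:Z by rewrite -lerBlDr sub0r.
rewrite inordK; first by rewrite gez0_abs // addrK.
by rewrite ltnS -lez_nat gez0_abs // [X in _ <= X]PoszD lerD2r.
Qed.

(* [fset_set] is a junk value on infinite sets; [finite_remainder_height] shows
   that this case does not arise. *)
Definition remainder (a b m n : nat) : nat :=
  #|` fset_set [set h | @remainder_height a b m n h]%classic|%fset.

Definition eval2 (P : {mpoly rat[2]}) (x y : rat) : rat :=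
  P.@[tnth [tuple x; y]].

(* [msize P] is one more than the total degree when P is nonzero, and 0 for
   P = 0; the zero polynomial thus gets degree 0. *)
Definition total_degree (P : {mpoly rat[2]}) : nat := (msize P).-1.

Definition agrees_from (N : nat) (f : nat -> nat -> nat) (P : {mpoly rat[2]}) :
    Prop :=
  forall m n : nat, (N <= m)%N -> (N <= n)%N ->
    (f m n)%:R = eval2 P m%:R n%:R.

(* Main.v *)
(* Write X and Y for the signs of the horizontal and vertical steps of a height
   function.  A row band (the steps between two consecutive rows) is straight
   when its signs are all equal.  A row between two straight bands of equal sign
   can be deleted or duplicated without changing the extrema or the sides they
   lie on, and likewise for columns.  Hence the remainder is the sum, over the
   finitely many reduced functions, of products of binomial coefficients of
   degrees k - 1 in m and l - 1 in n, where k and l are the numbers of straight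
   row and column bands of the reduced function, and it suffices to show
   k + l <= 7 when there are 8 extrema.

   If 2c is the number of sign changes along the boundary cycle, then a discrete
   Morse formula gives 8 = 1 + c + (face saddles) + (vertex saddles).  Charging
   half of each face saddle to its row band and half to its column band, the
   terms of this formula dominate k + l up to nonnegative local defects.  If
   k + l >= 8, the total defect is so small that either all the steps of one
   direction are equal, and then the minima lie on one side, or the grid has at
   most three bands in each direction. *)
Require Import Defs.
From mathcomp Require Import all_boot all_order all_algebra.
From mathcomp Require Import finmap classical_sets cardinality.
From mathcomp Require Import mpoly.
From mathcomp Require Import zify ring.

Set Implicit Arguments.
Unset Strict Implicit.
Unset Printing Implicit Defensive.

Import Order.TTheory GRing.Theory Num.Theory.

(** * Extrema and saddles along one row *)

(** Let [k], [l] count the straight row and column bands, [dr], [dc] be the defects of the two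
    words, [K] the number of extremal corners and [S] that of vertex saddles. Twice the Morse
    formula combined with the defect identities of rows and columns reads
    [2(k + l) + dr + dc + K + 2S = 18], so [k + l >= 8] means that the remaining terms sum to at
    most 2. No local estimate can improve this: if all vertical steps are equal and seven columns
    alternate, then [k + l = 8], and only the condition on the minima removes such grids. The cases
    within the bound 2 are therefore settled globally. The main tool is that a vertical and a
    horizontal turn of suitable signs cross in a vertex saddle, which costs 2. Outside the excluded
    case this leaves at most one switch of sign on every side, and a reduced grid of that shape has
    at most three bands in each direction, so [k + l <= 6]. *)

Definition changes (n : nat) (f : nat -> bool) : nat :=
  \sum_(j < n) (f j (+) f j.+1).

Lemma changesS (n : nat) (f : nat -> bool) :
  changes n.+1 f = changes n f + (f n (+) f n.+1).
Proof. by rewrite /changes big_ord_recr. Qed.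

(* Here [x] gives the signs of the steps along a row, [u] and [v] those of the
   vertical steps above and below it. *)
Definition row_extremum (q : nat) (x u v : nat -> bool) (j : nat) : bool :=
  [&& u j != v j, (0 < j) ==> (x j.-1 == u j) & (j < q) ==> (x j == v j)].

Definition row_saddle (q : nat) (x u v : nat -> bool) (j : nat) : bool :=
  [&& 0 < j < q, u j != v j, x j.-1 == v j & x j == u j].

(** On a maximal run of columns with constant [u != v], the hypotheses (the face rule above and
    below the row) force the step before the run to be [u] and the step after it to be [v]. Hence
    along the run the changes of [x] from [u] to [v], the extrema, outnumber those from [v] to [u],
    the saddles, by one; at an end of the row the missing step behaves in the same way. The other
    terms on the right count the ends of runs. *)
Lemma sum_row_extremum (q : nat) (x u v : nat -> bool) :
    0 < q ->
    (forall j, j < q -> u j != u j.+1 -> x j = ~~ u j) ->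
    (forall j, j < q -> v j != v j.+1 -> x j = v j) ->
  2 * \sum_(j < q.+1) row_extremum q x u v j =
  changes q u + changes q v + (u 0 (+) v 0) + (u q (+) v q) +
    2 * \sum_(j < q.+1) row_saddle q x u v j.
Proof.
move=> q0 hu hv.
pose E k := \sum_(j < k) row_extremum q x u v j.
pose W k := \sum_(j < k) row_saddle q x u v j.
have ES k : E k.+1 = E k + row_extremum q x u v k by rewrite /E big_ord_recr.
have WS k : W k.+1 = W k + row_saddle q x u v k by rewrite /W big_ord_recr.
(* Invariant of a left-to-right scan: the two correction terms record which of the two signs [x] has
   inside an unfinished run. *)
have prefix j : j < q ->
    2 * E j.+1 + ((u j != v j) && (x j == u j)) =
    changes j u + changes j v + (u 0 (+) v 0) + ((u j != v j) && (x j == v j)) +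
    2 * W j.+1.
  elim: j => [_|j IH jq].
    rewrite /changes !big_ord0 /E /W !big_ord1 /row_extremum /row_saddle q0 /=.
    by case: (u 0) (v 0) (x 0) => [] [] [].
  rewrite !changesS ES WS.
  move: (IH (ltnW jq)) (hu _ (ltnW jq)) (hv _ (ltnW jq)).
  rewrite /row_extremum /row_saddle jq /=.
  case: (u j) (v j) (u j.+1) (v j.+1) (x j) (x j.+1) => [] [] [] [] [] [] /=;
  lia.
rewrite -/(E q.+1) -/(W q.+1) ES WS.
case: q q0 hu hv @E @W ES WS prefix => // q _ hu hv E W ES WS prefix.
move: (prefix q (ltnSn _)) (hu _ (ltnSn _)) (hv _ (ltnSn _)).
rewrite !changesS /row_extremum /row_saddle !ltnn /=.
case: (u q) (v q) (u q.+1) (v q.+1) (x q) => [] [] [] [] [] /=; lia.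
Qed.

(** Written for the top row, with [v] the vertical steps leaving it; the bottom row is obtained by
    negating [v]. *)
Definition end_extremum (q : nat) (x v : nat -> bool) (j : nat) : bool :=
  ((0 < j) ==> (x j.-1 != v j)) && ((j < q) ==> (x j == v j)).

Lemma sum_end_extremum (q : nat) (x v : nat -> bool) :
    0 < q -> (forall j, j < q -> v j != v j.+1 -> x j = v j) ->
  2 * \sum_(j < q.+1) end_extremum q x v j =
  1 + changes q v + changes q.-1 x + (x 0 == v 0) + (x q.-1 != v q).
Proof.
move=> q0 hv.
pose E k := \sum_(j < k) end_extremum q x v j.
have ES k : E k.+1 = E k + end_extremum q x v k by rewrite /E big_ord_recr.
have prefix j : j < q ->
    2 * E j.+1 + (x j != v j) = 1 + changes j v + changes j x + (x 0 == v 0).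
  elim: j => [_|j IH jq].
    rewrite /changes !big_ord0 /E big_ord1 /end_extremum q0 /=.
    by case: (v 0) (x 0) => [] [].
  rewrite ES !changesS.
  move: (IH (ltnW jq)) (hv _ (ltnW jq)); rewrite /end_extremum jq /=.
  case: (v j) (v j.+1) (x j) (x j.+1) => [] [] [] [] /=; lia.
rewrite -/(E q.+1) ES.
case: q q0 hv @E ES prefix => // q _ hv E ES prefix.
move: (prefix q (ltnSn _)) (hv _ (ltnSn _)).
rewrite changesS /end_extremum !ltnn /=.
case: (v q) (v q.+1) (x q) => [] [] [] /=; lia.
Qed.

(** * Extrema and saddles of a grid of steps *)

(* The four steps around a face sum to zero; opposite steps differ exactly at
   face saddles. *)
Definition face_rule (p q : nat) (X Y : nat -> nat -> bool) : Prop :=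
  forall i j, i < p -> j < q ->
    X i j (+) X i.+1 j = Y i j (+) Y i j.+1 /\ (X i j != X i.+1 j -> X i j = Y i j).

(** [X i j] is the step from cell [(i, j)] to [(i, j + 1)] and [Y i j] the step to [(i + 1, j)],
    with [true] for up. Here [p] and [q] count bands, so there are [p + 1] rows of cells. *)
Definition minimum_at (p q : nat) (X Y : nat -> nat -> bool) (i j : nat) : bool :=
  [&& (0 < i) ==> ~~ Y i.-1 j, (i < p) ==> Y i j,
      (0 < j) ==> ~~ X i j.-1 & (j < q) ==> X i j].

Definition maximum_at (p q : nat) (X Y : nat -> nat -> bool) (i j : nat) : bool :=
  [&& (0 < i) ==> Y i.-1 j, (i < p) ==> ~~ Y i j,
      (0 < j) ==> X i j.-1 & (j < q) ==> ~~ X i j].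

Definition saddle_at (p q : nat) (X Y : nat -> nat -> bool) (i j : nat) : bool :=
  (0 < i < p) && row_saddle q (X i) (Y i.-1) (Y i) j.

(** The boundary cycle changes sign at a corner exactly when that corner is a local extremum. *)
Definition corner_extrema (p q : nat) (X Y : nat -> nat -> bool) : nat :=
  (X 0 0 == Y 0 0) + (X 0 q.-1 != Y 0 q) + (X p 0 != Y p.-1 0) +
  (X p q.-1 == Y p.-1 q).

Definition flip (X : nat -> nat -> bool) : nat -> nat -> bool := fun i j => X j i.

Lemma face_rule_flip (p q : nat) (X Y : nat -> nat -> bool) :
  face_rule p q X Y -> face_rule q p (flip Y) (flip X).
Proof.
move=> f j i jq ip; have [e s] := f i j ip jq; split; rewrite /flip.
  by rewrite -e.
by move: e s; case: (X i j) (X i.+1 j) (Y i j) (Y i j.+1) => [] [] [] [] //= _ ->.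
Qed.

(** The discrete Morse formula, doubled, as the sum of the row identities. The changes in a row band
    enter through both rows adjoining it; by the face rule one of the two copies can be counted by
    columns, which makes the formula symmetric. *)
Lemma sum_extrema (p q : nat) (X Y : nat -> nat -> bool) :
    0 < p -> 0 < q -> face_rule p q X Y ->
  2 * \sum_(i < p.+1) \sum_(j < q.+1)
        (minimum_at p q X Y i j + maximum_at p q X Y i j) =
  2 + (\sum_(j < q) changes p (flip X j) + changes q.-1 (X 0) + changes q.-1 (X p))
    + (\sum_(i < p) changes q (Y i) + changes p.-1 (flip Y 0) + changes p.-1 (flip Y q))
    + corner_extrema p q X Y
    + 2 * \sum_(i < p.+1) \sum_(j < q.+1) saddle_at p q X Y i j.
Proof.
case: p => // p _ q0 f.
have ex : \sum_(j < q) changes p.+1 (flip X j) = \sum_(i < p.+1) changes q (Y i).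
  rewrite exchange_big; apply: eq_bigr => i _; apply: eq_bigr => j _ /=.
  by have [-> _] := f i j (ltn_ord i) (ltn_ord j).
have top : 2 * \sum_(j < q.+1) (minimum_at p.+1 q X Y 0 j + maximum_at p.+1 q X Y 0 j) =
    1 + changes q (Y 0) + changes q.-1 (X 0) + (X 0 0 == Y 0 0) + (X 0 q.-1 != Y 0 q).
  rewrite -sum_end_extremum //; last first.
    move=> j jq; have [e s] := f 0 j isT jq; move: e s.
    by case: (X 0 j) (X 1 j) (Y 0 j) (Y 0 j.+1) => [] [] [] [] //= _ ->.
  congr (2 * _); apply: eq_bigr => j _.
  rewrite /minimum_at /maximum_at /end_extremum /=; have := ltn_ord j.
  case: (posnP j) => [->|]; first by rewrite q0; case: (X 0 0) (Y 0 0) => [] [].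
  case: (ltnP j q) => [|?]; last first.
    by case: (X 0 j.-1) (Y 0 j) => [] [].
  by case: (X 0 j.-1) (Y 0 j) (X 0 j) => [] [] [].
have bot : 2 * \sum_(j < q.+1) (minimum_at p.+1 q X Y p.+1 j + maximum_at p.+1 q X Y p.+1 j) =
    1 + changes q (Y p) + changes q.-1 (X p.+1) + (X p.+1 0 != Y p 0) +
    (X p.+1 q.-1 == Y p q).
  have e1 : changes q (Y p) = changes q (fun j => ~~ Y p j).
    by apply: eq_bigr => j _; rewrite addNb addbN negbK.
  have -> : (X p.+1 0 != Y p 0) = (X p.+1 0 == ~~ Y p 0) by case: (X _ _) (Y _ _) => [] [].
  have -> : (X p.+1 q.-1 == Y p q) = (X p.+1 q.-1 != ~~ Y p q).
    by case: (X _ _) (Y _ _) => [] [].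
  rewrite e1 -(@sum_end_extremum q _ (fun j => ~~ Y p j)) //; last first.
    move=> j jq; have [e s] := f p j (ltnSn _) jq; move: e s.
    by case: (X p j) (X p.+1 j) (Y p j) (Y p j.+1) => [] [] [] [] //= _ ->.
  congr (2 * _); apply: eq_bigr => j _.
  rewrite /minimum_at /maximum_at /end_extremum ltnn /=; have := ltn_ord j.
  case: (posnP j) => [->|]; first by rewrite q0; case: (X _ 0) (Y p 0) => [] [].
  case: (ltnP j q) => [|?]; last first.
    by case: (X _ j.-1) (Y p j) => [] [].
  by case: (X _ j.-1) (Y p j) (X _ j) => [] [] [].
have mid (i : nat) : i < p ->
    2 * \sum_(j < q.+1) (minimum_at p.+1 q X Y i.+1 j + maximum_at p.+1 q X Y i.+1 j) =
    changes q (Y i) + changes q (Y i.+1) + (Y i 0 (+) Y i.+1 0) + (Y i q (+) Y i.+1 q)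
    + 2 * \sum_(j < q.+1) saddle_at p.+1 q X Y i.+1 j.
  move=> ip; have -> : \sum_(j < q.+1) saddle_at p.+1 q X Y i.+1 j =
      \sum_(j < q.+1) row_saddle q (X i.+1) (Y i) (Y i.+1) j.
    by apply: eq_bigr => j _; rewrite /saddle_at ltn0Sn (ltnS i.+1) ip.
  rewrite -sum_row_extremum //; first last.
  - move=> j jq; have [e s] := f i.+1 j ip jq; move: e s.
    by case: (X _ j) (X _ j) (Y _ j) (Y _ j.+1) => [] [] [] [] //= _ ->.
  - move=> j jq; have [e s] := f i j (ltnW ip) jq; move: e s.
    by case: (X _ j) (X _ j) (Y _ j) (Y _ j.+1) => [] [] [] [] //= _ ->.
  congr (2 * _); apply: eq_bigr => j _.
  rewrite /minimum_at /maximum_at /row_extremum ltn0Sn (ltnS i.+1) ip /=; have := ltn_ord j.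
  case: (posnP j) => [->|].
    by rewrite q0; case: (X _ 0) (Y i 0) (Y i.+1 0) => [] [] [].
  case: (ltnP j q) => [|?]; last first.
    by case: (X _ j.-1) (Y i j) (Y i.+1 j) => [] [] [].
  by case: (X _ j.-1) (Y i j) (Y i.+1 j) (X _ j) => [] [] [] [].
have nosad i : ~~ (0 < i < p.+1) -> \sum_(j < q.+1) saddle_at p.+1 q X Y i j = 0.
  by move=> /negPf h; rewrite big1 // => j _; rewrite /saddle_at h.
have ends (g : nat -> nat) :
    \sum_(i < p.+2) g i = g 0 + \sum_(i < p) g i.+1 + g p.+1.
  by rewrite big_ord_recr big_ord_recl.
pose M i := \sum_(j < q.+1) (minimum_at p.+1 q X Y i j + maximum_at p.+1 q X Y i j).
pose S i := \sum_(j < q.+1) saddle_at p.+1 q X Y i j.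
rewrite -[X in _ * X = _]/(\sum_(i < p.+2) M i) (ends M).
rewrite -[X in _ = _ + _ * X]/(\sum_(i < p.+2) S i) (ends S).
have midsum : 2 * \sum_(i < p) M i.+1 =
    \sum_(i < p) changes q (Y i) + \sum_(i < p) changes q (Y i.+1) +
    \sum_(i < p) (Y i 0 (+) Y i.+1 0) + \sum_(i < p) (Y i q (+) Y i.+1 q) +
    2 * \sum_(i < p) S i.+1.
  rewrite !big_distrr -!big_split /=; apply: eq_bigr => i _.
  exact: mid (ltn_ord i).
rewrite !mulnDr top bot midsum {2 4}/S !nosad ?ltnn ?andbF // ex.
have -> : 2 + (\sum_(i < p.+1) changes q (Y i) + changes q.-1 (X 0) + changes q.-1 (X p.+1)) =
   2 + (changes q (Y 0) + \sum_(i < p) changes q (Y i.+1) +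
        changes q.-1 (X 0) + changes q.-1 (X p.+1)).
  by rewrite big_ord_recl.
rewrite [in RHS]big_ord_recr /corner_extrema /= /changes /flip; ring.
Qed.

(** * Words of bands and their defect *)

Definition band_word (n : nat) (t b : nat -> bool) (s : nat -> nat) : Prop :=
  (forall j, j < n -> odd (s j) = t j (+) b j) /\
  (forall j, j.+1 < n -> s j = 0 -> s j.+1 = 0 -> t j != t j.+1).

(* For the columns, [t] and [b] are the top and bottom signs of a band and [s]
   its number of face saddles.  A new straight run is worth 2, and the potential
   is chosen so that the subtractions below do not truncate on band words: the
   defect is a sum of local nonnegative costs. *)
Definition potential (t b : nat -> bool) (s : nat -> nat) (j : nat) : nat :=
  if s j == 0 then 0 else if t j == b j then 2 else 1.

Definition first_cost (t b : nat -> bool) (s : nat -> nat) : nat :=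
  s 0 + 2 - 2 * (s 0 == 0) - potential t b s 0.

Definition step_cost (t b : nat -> bool) (s : nat -> nat) (j : nat) : nat :=
  s j.+1 + (t j (+) t j.+1) + (b j (+) b j.+1) + potential t b s j
    - 2 * (s j.+1 == 0) - potential t b s j.+1.

Definition defect (n : nat) (t b : nat -> bool) (s : nat -> nat) : nat :=
  first_cost t b s + \sum_(j < n.-1) step_cost t b s j + potential t b s n.-1.

Lemma parity_half (m : nat) (c : bool) : odd m = c -> exists k, m = c + 2 * k.
Proof. by move=> <-; exists m./2; rewrite -{1}(odd_double_half m) mul2n. Qed.

Ltac split_parity h j :=
  let k := fresh "k" in let e := fresh "e" in
  have [k e] := parity_half (h j ltac:(lia)); move: e.

(** The potentials telescope, so only the truncated subtractions need care: parity and reducedness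
    keep every local cost nonnegative. The summand 2 on the left is the one in [first_cost]. *)
Lemma defectE (n : nat) (t b : nat -> bool) (s : nat -> nat) :
    0 < n -> band_word n t b s ->
  \sum_(j < n) s j + changes n.-1 t + changes n.-1 b + 2 =
  2 * \sum_(j < n) (s j == 0) + defect n t b s.
Proof.
case: n => // n _ [par red]; rewrite /defect /=.
elim: n par red => [|n IH] par red.
  split_parity par 0; rewrite /changes !big_ord0 !big_ord1 /first_cost /potential.
  by case: (t 0) (b 0) => [] [] /=; case: eqP => /=; lia.
have {}IH := IH (fun j h => par j (ltnW h)) (fun j h => red j (ltnW h)).
rewrite !changesS [\sum_(j < n.+2) s j]big_ord_recr /=.
rewrite [\sum_(j < n.+2) _]big_ord_recr /= [\sum_(j < n.+1) step_cost _ _ _ _]big_ord_recr /=.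
move: IH (red n (ltnSn _)); split_parity par n; split_parity par n.+1; rewrite /step_cost.
set F := first_cost _ _ _; set S := \sum_(_ < n) _; set C := changes _ _; set C' := changes _ _.
rewrite /potential; case: (s n =P 0); case: (s n.+1 =P 0).
- case: (t n) (b n) (t n.+1) (b n.+1) => [] [] [] [] /= *; lia.
- case: (t n) (b n) (t n.+1) (b n.+1) => [] [] [] [] /= *; lia.
- case: (t n) (b n) (t n.+1) (b n.+1) => [] [] [] [] /= *; lia.
case: (t n) (b n) (t n.+1) (b n.+1) => [] [] [] [] /= *; lia.
Qed.

Lemma leq_sum_term (n j : nat) (f : nat -> nat) : j < n -> f j <= \sum_(i < n) f i.
Proof. by move=> h; rewrite (bigD1 (Ordinal h)) //= leq_addr. Qed.

Lemma leq_sum_terms (n i j : nat) (f : nat -> nat) :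
  i < n -> j < n -> i != j -> f i + f j <= \sum_(k < n) f k.
Proof.
move=> hi hj ij; rewrite (bigD1 (Ordinal hi)) //= (bigD1 (Ordinal hj)) /=; last first.
  by rewrite -val_eqE eq_sym.
by rewrite addnA leq_addr.
Qed.

Lemma first_cost_straight (t b : nat -> bool) (s : nat -> nat) :
  odd (s 0) = t 0 (+) b 0 -> first_cost t b s < 2 -> s 0 = 0.
Proof.
move=> /parity_half[k]; rewrite /first_cost /potential; case: (s 0 =P 0) => //.
by case: (t 0) (b 0) => [] [] /=; lia.
Qed.

(* A band word with a small defect is built from straight bands and letters of
   this kind, up to a single exception. *)
Definition even_letter (t b : nat -> bool) (s : nat -> nat) (j : nat) : Prop :=
  t j = b j /\ (s j = 0 \/ s j = 2).

(** A straight band is entered for free from a straight band, from a band with an odd number of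
    saddles, or from an even one without change of sign; a band with two saddles only from a
    straight band of the same sign; an odd band never. *)
Lemma step_cost0 (n j : nat) (t b : nat -> bool) (s : nat -> nat) :
    band_word n t b s -> j.+1 < n -> step_cost t b s j = 0 ->
  even_letter t b s j.+1 /\
  (even_letter t b s j -> t j != t j.+1 -> s j = 0 /\ s j.+1 = 0).
Proof.
move=> [par red] jn; rewrite /even_letter /step_cost /potential.
split_parity par j; split_parity par j.+1.
case: (s j =P 0); case: (s j.+1 =P 0);
case: (t j) (b j) (t j.+1) (b j.+1) => [] [] [] [] /= *; lia.
Qed.

Lemma step_cost1 (n j : nat) (t b : nat -> bool) (s : nat -> nat) :
    band_word n t b s -> j.+1 < n -> even_letter t b s j -> step_cost t b s j = 1 ->
  s j.+1 = 1.
Proof.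
move=> [par red] jn; rewrite /even_letter /step_cost /potential.
split_parity par j; split_parity par j.+1.
case: (s j =P 0); case: (s j.+1 =P 0);
case: (t j) (b j) (t j.+1) (b j.+1) => [] [] [] [] /= *; lia.
Qed.

Lemma step_cost_enter (n j : nat) (t b : nat -> bool) (s : nat -> nat) :
    band_word n t b s -> j.+1 < n -> t j.+1 != b j.+1 -> 0 < step_cost t b s j.
Proof.
move=> [par red] jn; rewrite /step_cost /potential.
split_parity par j; split_parity par j.+1.
case: (s j =P 0); case: (s j.+1 =P 0);
case: (t j) (b j) (t j.+1) (b j.+1) => [] [] [] [] /= *; lia.
Qed.

Lemma defect_eq0 (n : nat) (t b : nat -> bool) (s : nat -> nat) :
    0 < n -> band_word n t b s -> defect n t b s = 0 ->
  [/\ s 0 = 0, s n.-1 = 0, forall j, j < n -> even_letter t b s j &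
      forall j, j.+1 < n -> t j != t j.+1 -> s j = 0 /\ s j.+1 = 0].
Proof.
move=> n0 w; rewrite /defect => d0.
have s0 : s 0 = 0.
  by apply: (@first_cost_straight t b); [case: w => par _; exact: par | lia].
have ev j : j < n -> even_letter t b s j.
  case: j => [_|j jn].
    by split; [case: w => /(_ 0 n0); rewrite s0; case: (t 0) (b 0) => [] [] | left].
  have h : j < n.-1 by lia.
  have := leq_sum_term (step_cost t b s) h => hs.
  by apply: (step_cost0 w jn _).1; lia.
split=> //; first by move: d0; rewrite /potential; case: eqP => // _; case: ifP; lia.
move=> j jn; have h : j < n.-1 by lia.
have := leq_sum_term (step_cost t b s) h => hs.
by apply: (step_cost0 w jn _).2; [lia | exact: ev (ltnW jn)].
Qed.

(** From an even letter, a single unit can only be spent on entering a band with one saddle, whose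
    two ends have different signs. All other steps are free. *)
Lemma defect_eq1 (n : nat) (t b : nat -> bool) (s : nat -> nat) :
    0 < n -> band_word n t b s -> defect n t b s = 1 ->
  [/\ s 0 = 0, s n.-1 = 0 & exists j0, [/\ 0 < j0 < n.-1, s j0 = 1,
     forall j, j < n -> j != j0 -> even_letter t b s j &
     forall j, j.+1 < n -> j != j0 -> j.+1 != j0 -> t j != t j.+1 ->
       s j = 0 /\ s j.+1 = 0]].
Proof.
move=> n0 w d1.
have [par red] := w.
have s0 : s 0 = 0.
  by apply: (@first_cost_straight t b); [exact: par | move: d1; rewrite /defect; lia].
(* A last band with saddles has potential 2 if its ends agree; otherwise it has potential 1, and
   entering it costs at least 1 more. *)
have sn : s n.-1 = 0.
  case: (n =P 1) => [-> //|n1].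
  have nn : n = n.-2.+2 by lia.
  have h : n.-2 < n.-1 by lia.
  have h' : n.-2.+1 < n by lia.
  have := leq_sum_term (step_cost t b s) h.
  have := step_cost_enter w h'; rewrite -[n.-2.+1]/(n.-2.+2.-1) -nn.
  move: d1; rewrite /defect /potential; case: eqP => //; case: eqP => /= _ _ d1 e l.
    by move: d1; lia.
  by have := e isT; lia.
have p0 : potential t b s n.-1 = 0 by rewrite /potential sn.
have f0 : first_cost t b s = 0 by rewrite /first_cost /potential s0.
have S1 : \sum_(j < n.-1) step_cost t b s j = 1 by move: d1; rewrite /defect p0 f0; lia.
have [j jn cj] : exists2 j, j < n.-1 & step_cost t b s j != 0.
  have : \sum_(j < n.-1) step_cost t b s j != 0 by rewrite S1.
  by rewrite sum_nat_eq0 negb_forall => /existsP[j]; exists j => //=.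
have cj1 : step_cost t b s j = 1 by have := leq_sum_term (step_cost t b s) jn; lia.
have oth i : i < n.-1 -> i != j -> step_cost t b s i = 0.
  by move=> hi ij; have := leq_sum_terms (step_cost t b s) hi jn ij; lia.
have e0 : even_letter t b s 0.
  by split; [move: (par 0 n0); rewrite s0; case: (t 0) (b 0) => [] [] | left].
have ev i : i < n -> i != j.+1 -> even_letter t b s i.
  case: i => [//|i hi ij].
  by apply: (step_cost0 w hi _).1; apply: oth; [lia | move: ij; rewrite eqSS].
have jn' : j.+1 < n by lia.
have sj : s j.+1 = 1.
  by apply: (step_cost1 w jn' _ cj1); apply: ev; lia.
split=> //; exists j.+1; split=> //.
  have : j.+1 != n.-1 by apply/eqP => e; move: sj; rewrite e sn.
  by lia.
move=> i hi ij ij'; have hi' : i < n.-1 by lia.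
apply: (step_cost0 w hi _).2; first by apply: oth.
by apply: ev; [exact: ltnW | ].
Qed.

Lemma defect_ends (n : nat) (t b : nat -> bool) (s : nat -> nat) :
    0 < n -> band_word n t b s -> s 0 != 0 -> s n.-1 != 0 -> 2 < defect n t b s.
Proof.
move=> n0 [par red] s0 sn; rewrite /defect.
have : 1 < first_cost t b s.
  by rewrite ltnNge; apply/negP => h; move: s0; rewrite (first_cost_straight (par 0 n0)).
have : 0 < potential t b s n.-1 by rewrite /potential (negPf sn); case: ifP.
lia.
Qed.

(** Opening with saddles costs at least 2. The potential 2 of the first band would be recovered in
    full only by a straight band of the same sign, which is excluded, so the next step costs at
    least 1. *)
Lemma defect_first (n : nat) (t b : nat -> bool) (s : nat -> nat) :
    0 < n -> band_word n t b s -> s 0 != 0 -> t 0 = b 0 -> s n.-1 = 0 ->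
    (forall j, j < n -> s j = 0 -> t j != t 0) ->
  2 < defect n t b s.
Proof.
move=> n0 w s0 tb sn st; have [par red] := w; rewrite /defect.
have n1 : 1 < n by case: n n0 sn {w par st red} => [|[|n]] //= _ e; rewrite e in s0.
have : 1 < first_cost t b s.
  by rewrite ltnNge; apply/negP => h; move: s0; rewrite (first_cost_straight (par 0 n0)).
have h : 0 < n.-1 by lia.
have := leq_sum_term (step_cost t b s) h.
have : 0 < step_cost t b s 0.
  have := st 1 n1; move: tb s0; rewrite /step_cost /potential.
  split_parity par 0; split_parity par 1.
  case: (s 0 =P 0); case: (s 1 =P 0);
  case: (t 0) (b 0) (t 1) (b 1) => [] [] [] [] /= *; lia.
lia.
Qed.

(** Mirror image of [defect_first]: the final potential is 2, and entering the last band is not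
    free, since it is not preceded by a straight band of its own sign. *)
Lemma defect_last (n : nat) (t b : nat -> bool) (s : nat -> nat) :
    0 < n -> band_word n t b s -> s n.-1 != 0 -> t n.-1 = b n.-1 -> s 0 = 0 ->
    (forall j, j < n -> s j = 0 -> t j != t n.-1) ->
  2 < defect n t b s.
Proof.
move=> n0 w s0 tb sn st; have [par red] := w; rewrite /defect.
have n1 : 1 < n by case: n n0 s0 {w par st red tb} => [|[|n]] //= _; rewrite sn.
have : potential t b s n.-1 = 2 by rewrite /potential (negPf s0) tb eqxx.
have nn : n = n.-2.+2 by lia.
have h : n.-2 < n.-1 by lia.
have h1 : n.-2 < n by lia.
have := leq_sum_term (step_cost t b s) h.
have : 0 < step_cost t b s n.-2.
  have := st n.-2 h1; move: tb s0; rewrite /step_cost /potential.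
  have e1 : n.-1 = n.-2.+1 by lia.
  rewrite e1; split_parity par n.-2; split_parity par n.-2.+1.
  case: (s n.-2 =P 0); case: (s n.-2.+1 =P 0);
  case: (t n.-2) (b n.-2) (t n.-2.+1) (b n.-2.+1) => [] [] [] [] /= *; lia.
lia.
Qed.

(** * Saddles in a reduced grid *)

Definition col_saddles (p : nat) (X : nat -> nat -> bool) (j : nat) : nat :=
  changes p (flip X j).
Definition row_saddles (q : nat) (Y : nat -> nat -> bool) (i : nat) : nat :=
  changes q (Y i).

Definition reduced_grid (p q : nat) (X Y : nat -> nat -> bool) : Prop :=
  [/\ 0 < p, 0 < q, face_rule p q X Y,
      band_word q (X 0) (X p) (col_saddles p X) &
      band_word p (flip Y 0) (flip Y q) (row_saddles q Y)].

Lemma reduced_grid_flip (p q : nat) (X Y : nat -> nat -> bool) :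
  reduced_grid p q X Y -> reduced_grid q p (flip Y) (flip X).
Proof. by case=> p0 q0 f c r; split=> //; exact: face_rule_flip. Qed.

Lemma saddle_at_flip (p q : nat) (X Y : nat -> nat -> bool) (i j : nat) :
  saddle_at q p (flip Y) (flip X) j i = saddle_at p q X Y i j.
Proof.
rewrite /saddle_at /row_saddle /flip.
case: (0 < i < p); case: (0 < j < q) => //=.
by case: (X i j.-1) (X i j) (Y i.-1 j) (Y i j) => [] [] [] [].
Qed.

Lemma corner_extrema_flip (p q : nat) (X Y : nat -> nat -> bool) :
  corner_extrema q p (flip Y) (flip X) = corner_extrema p q X Y.
Proof.
rewrite /corner_extrema /flip.
rewrite (eq_sym (Y 0 0)) (eq_sym (Y p.-1 0)) (eq_sym (Y 0 q)) (eq_sym (Y p.-1 q)).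
ring.
Qed.

Lemma changes0 (n : nat) (f : nat -> bool) (j : nat) :
  changes n f = 0 -> j <= n -> f j = f 0.
Proof.
move=> /eqP; rewrite sum_nat_eq0 => /forallP h.
elim: j => // j IH jn; rewrite -IH; last exact: ltnW.
by have := h (Ordinal jn) => /=; case: (f j) (f j.+1) => [] [].
Qed.

Lemma odd_changes (n : nat) (f : nat -> bool) : odd (changes n f) = f 0 (+) f n.
Proof.
elim: n => [|n IH]; first by rewrite /changes big_ord0 addbb.
by rewrite changesS oddD IH oddb addbA addbK.
Qed.

Lemma crossing (f : nat -> bool) (c : bool) (a b : nat) :
  a <= b -> f a = ~~ c -> f b = c ->
  exists j, [/\ a <= j, j.+1 <= b, f j = ~~ c & f j.+1 = c].
Proof.
elim: b => [|b IH].
  by rewrite leqn0 => /eqP -> ->; case: c.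
rewrite leq_eqVlt => /orP[/eqP -> ->|ab fa fb]; first by case: (c).
case: (f b =P c) => [e|ne].
  by have [j [h1 h2 h3 h4]] := IH ab fa e; exists j; split=> //; exact: leqW.
by exists b; split=> //; move/eqP: ne; case: (f b); case: (c).
Qed.

Lemma col_straight (p j i : nat) (X : nat -> nat -> bool) :
  col_saddles p X j = 0 -> i <= p -> X i j = X 0 j.
Proof. by move=> h; exact: (@changes0 p (flip X j)). Qed.

Lemma row_straight (q i j : nat) (Y : nat -> nat -> bool) :
  row_saddles q Y i = 0 -> j <= q -> Y i j = Y i 0.
Proof. exact: changes0. Qed.

Lemma no_col_saddle (p q i j k : nat) (X Y : nat -> nat -> bool) :
    face_rule p q X Y -> i < p -> j <= k -> k <= q ->
    (forall l, j <= l -> l < k -> col_saddles p X l = 0) -> Y i k = Y i j.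
Proof.
move=> f ip; elim: k => [|k IH].
  by rewrite leqn0 => /eqP->.
rewrite leq_eqVlt => /orP[/eqP-> //|jk] kq st.
rewrite -IH //; [|exact: ltnW|by move=> l h1 h2; apply: st => //; exact: leqW].
have [e _] := f i k ip kq; have := st k jk (ltnSn _) => s.
move: e; rewrite !(col_straight s) //; last exact: ltnW.
by rewrite addbb; case: (Y i k) (Y i k.+1) => [] [].
Qed.

(* Across a turn row, of vertical sign [c] then [~~ c], horizontal steps going
   from [~~ c] to [c] meet a vertex saddle. *)
Lemma turn_row_saddle (p q i a b : nat) (c : bool) (X Y : nat -> nat -> bool) :
    i.+1 < p -> row_saddles q Y i = 0 -> row_saddles q Y i.+1 = 0 ->
    Y i 0 = c -> Y i.+1 0 = ~~ c ->
    a <= b -> b < q -> X i.+1 a = ~~ c -> X i.+1 b = c ->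
  exists2 j, j < q.+1 & saddle_at p q X Y i.+1 j.
Proof.
move=> ip si si1 yi yi1 ab bq xa xb.
have [j [aj jb xj xj1]] := crossing ab xa xb.
have jq : j.+1 <= q by exact: leq_trans jb (ltnW bq).
exists j.+1 => //; rewrite /saddle_at /row_saddle /=.
rewrite (row_straight si jq) (row_straight si1 jq) yi yi1 xj xj1 ip.
by rewrite (leq_ltn_trans jb bq) !eqxx; case: (c).
Qed.

Lemma even_saddle_column (p j : nat) (X : nat -> nat -> bool) :
    col_saddles p X j != 0 -> X 0 j = X p j ->
  exists i1 i2, [/\ i1 < i2, i2 < p, X i1 j = X 0 j /\ X i1.+1 j = ~~ X 0 j &
                   X i2 j = ~~ X 0 j /\ X i2.+1 j = X 0 j].
Proof.
move=> sj e.
have [i ip ne] : exists2 i, i <= p & X i j != X 0 j.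
  case: (boolP [forall i : 'I_p.+1, X i j == X 0 j]) => [/forallP h|].
    case/negP: sj; rewrite /col_saddles /changes sum_nat_eq0; apply/forallP => i /=.
    have := h (lift ord0 i); have := h (widen_ord (leqnSn p) i); rewrite /= /bump /= add1n /flip.
    by move=> /eqP-> /eqP->; rewrite addbb.
  by rewrite negb_forall => /existsP[i h]; exists i => //; rewrite -ltnS ltn_ord.
have xi : X i j = ~~ X 0 j by case: (X i j) (X 0 j) ne => [] [].
have [i1 [_ h1 a1 b1]] : exists i1,
    [/\ 0 <= i1, i1.+1 <= i, X i1 j = ~~ ~~ X 0 j & X i1.+1 j = ~~ X 0 j].
  by apply: (@crossing (flip X j)) => //; rewrite /flip negbK.
have [i2 [g2 h2 a2 b2]] : exists i2,
    [/\ i <= i2, i2.+1 <= p, X i2 j = ~~ X 0 j & X i2.+1 j = X 0 j].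
  by apply: (@crossing (flip X j)).
rewrite negbK in a1.
by exists i1, i2; split=> //; exact: leq_trans h1 g2.
Qed.

(* To the left of the first saddle column the vertical steps are constant along
   each row, so the alternating saddles of that column show on the left side. *)
Lemma leftmost_saddle_column (p q j : nat) (X Y : nat -> nat -> bool) :
    face_rule p q X Y -> j < q -> (forall k, k < j -> col_saddles p X k = 0) ->
    col_saddles p X j != 0 -> X 0 j = X p j ->
  exists i1 i2, [/\ i1 < i2, i2 < p, Y i1 0 = X 0 j & Y i2 0 = ~~ X 0 j].
Proof.
move=> f jq st sj e; have [i1 [i2 [h1 h2 [a1 b1] [a2 b2]]]] := even_saddle_column sj e.
have c0 i : i < p -> Y i j = Y i 0.
  move=> ip; apply: (no_col_saddle f ip) => //; first exact: ltnW.
  by move=> l _; exact: st.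
exists i1, i2; split=> //; rewrite -c0 //; try exact: ltn_trans h1 h2.
  have [_ <-] := f i1 j (ltn_trans h1 h2) jq => //.
  by rewrite a1 b1; case: (X 0 j).
have [_ <-] := f i2 j h2 jq => //.
by rewrite a2 b2; case: (X 0 j).
Qed.

(** The signs are exchanged with respect to the left side: in a saddle face the left vertical step
    has the sign of the upper horizontal one, and the right vertical step the opposite sign. *)
Lemma rightmost_saddle_column (p q j : nat) (X Y : nat -> nat -> bool) :
    face_rule p q X Y -> j < q -> (forall k, j < k < q -> col_saddles p X k = 0) ->
    col_saddles p X j != 0 -> X 0 j = X p j ->
  exists i1 i2, [/\ i1 < i2, i2 < p, Y i1 q = ~~ X 0 j & Y i2 q = X 0 j].
Proof.
move=> f jq st sj e; have [i1 [i2 [h1 h2 [a1 b1] [a2 b2]]]] := even_saddle_column sj e.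
have c0 i : i < p -> Y i q = Y i j.+1.
  move=> ip; apply: (no_col_saddle f ip) => // l h h'; apply: st.
  by rewrite h h'.
exists i1, i2; split=> //; rewrite c0 //; try exact: ltn_trans h1 h2.
  have [h g] := f i1 j (ltn_trans h1 h2) jq; move: h g; rewrite a1 b1.
  by case: (X 0 j) (Y i1 j) (Y i1 j.+1) => [] [] [] //= _ h; have := h isT.
have [h g] := f i2 j h2 jq; move: h g; rewrite a2 b2.
by case: (X 0 j) (Y i2 j) (Y i2 j.+1) => [] [] [] //= _ h; have := h isT.
Qed.

(** The signs on two opposite sides of the grid switch once, at the same place. Nothing is required
    at [k] itself, which leaves room for one exceptional band. *)
Definition threshold (n : nat) (f g : nat -> bool) (c : bool) (k : nat) : Prop :=
  (forall j, j < n -> j < k -> f j = ~~ c /\ g j = ~~ c) /\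
  (forall j, j < n -> k < j -> f j = c /\ g j = c).

Lemma threshold_mono (n i j k : nat) (f g : nat -> bool) (c : bool) :
  threshold n f g c k -> i < j -> j < n ->
  ~ (f i = c /\ f j = ~~ c) /\ ~ (g i = c /\ g j = ~~ c).
Proof.
move=> [lo hi] ij jn; split=> -[ei ej].
  have ik : k <= i.
    rewrite leqNgt; apply/negP => h; have [h1 _] := lo i (ltn_trans ij jn) h.
    by move: h1; rewrite ei; case: (c).
  have [h1 _] := hi j jn (leq_ltn_trans ik ij).
  by move: h1; rewrite ej; case: (c).
have ik : k <= i.
  rewrite leqNgt; apply/negP => h; have [_ h1] := lo i (ltn_trans ij jn) h.
  by move: h1; rewrite ei; case: (c).
have [_ h1] := hi j jn (leq_ltn_trans ik ij).
by move: h1; rewrite ej; case: (c).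
Qed.

(** A leftmost saddle column before [j0] would have both ends [~~ c] and show [~~ c] above [c] on
    the left side, against the switch of the rows from [c] to [~~ c]. A rightmost one after [j0]
    fails likewise on the right side. So only column [j0] can have saddles, and reducedness allows
    one column on each side of it. *)
Lemma threshold_cols (p q i0 j0 : nat) (c : bool) (X Y : nat -> nat -> bool) :
    reduced_grid p q X Y -> threshold q (X 0) (X p) c j0 ->
    threshold p (flip Y 0) (flip Y q) (~~ c) i0 -> q <= 3.
Proof.
move=> [p0 q0 f [_ red] _] tc tr.
have [lo hi] := tc.
have tb j : j < q -> j != j0 -> X 0 j = X p j.
  move=> jq; rewrite neq_ltn => /orP[h|h]; first by have [-> ->] := lo j jq h.
  by have [-> ->] := hi j jq h.
have only j : j < q -> col_saddles p X j != 0 -> j = j0.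
  move=> jq sj.
  have exl : exists k, (k < q) && (col_saddles p X k != 0) by exists j; rewrite jq.
  have [l /andP[lq sl] lmin] := ex_minnP exl.
  have bd k : (k < q) && (col_saddles p X k != 0) -> k <= q by move=> /andP[/ltnW].
  have [r /andP[rq sr] rmax] := ex_maxnP exl bd.
  have lj : l <= j by apply: lmin; rewrite jq.
  have jr : j <= r by apply: rmax; rewrite jq.
  have jl : j0 <= l.
    rewrite leqNgt; apply/negP => h.
    have [] := @leftmost_saddle_column p q l X Y f lq _ sl.
    - move=> k kl; apply/eqP; apply/negPn/negP => sk; have := lmin k.
      by rewrite sk (ltn_trans kl lq) => /(_ isT); rewrite leqNgt kl.
    - by apply: tb => //; rewrite ltn_eqF.
    have [xl _] := lo l lq h.
    move=> i1 [i2 [h1 h2 e1 e2]].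
    have [g _] := threshold_mono tr h1 h2; apply: g; rewrite /flip.
    by rewrite e1 e2 xl.
  have rj : r <= j0.
    rewrite leqNgt; apply/negP => h.
    have [] := @rightmost_saddle_column p q r X Y f rq _ sr.
    - move=> k /andP[kl kq]; apply/eqP; apply/negPn/negP => sk; have := rmax k.
      by rewrite sk kq => /(_ isT); rewrite leqNgt kl.
    - by apply: tb => //; rewrite gtn_eqF.
    have [xr _] := hi r rq h.
    move=> i1 [i2 [h1 h2 e1 e2]].
    have [_ g] := threshold_mono tr h1 h2; apply: g; rewrite /flip.
    by rewrite e1 e2 xr negbK.
  by apply/eqP; rewrite eqn_leq (leq_trans jr rj) (leq_trans jl lj).
have st j : j < q -> j != j0 -> col_saddles p X j = 0.
  by move=> jq ne; apply/eqP; apply/negPn/negP => /(only _ jq) e; rewrite e eqxx in ne.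
(* With four columns, either columns 0 and 1 lie before [j0] or columns 2 and 3 lie after it: two
   adjacent straight bands of equal sign. *)
rewrite leqNgt; apply/negP => q4.
case: (ltnP 1 j0) => h.
  have := red 0 (ltnW (ltnW q4)); rewrite !st //; try lia.
  have [-> _] := lo 0 q0 (ltnW h); have [-> _] := lo 1 (ltnW (ltnW q4)) h.
  by rewrite eqxx => /(_ erefl erefl).
have := red 2 q4; rewrite !st //; try lia.
have [|-> _] := hi 2 (ltnW q4); first lia.
have [|-> _] := hi 3 q4; first lia.
by rewrite eqxx => /(_ erefl erefl).
Qed.

Definition saddle_count (p q : nat) (X Y : nat -> nat -> bool) : nat :=
  \sum_(i < p.+1) \sum_(j < q.+1) saddle_at p q X Y i j.

Lemma saddle_count_flip (p q : nat) (X Y : nat -> nat -> bool) :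
  saddle_count q p (flip Y) (flip X) = saddle_count p q X Y.
Proof.
rewrite /saddle_count exchange_big; apply: eq_bigr => i _; apply: eq_bigr => j _.
by rewrite saddle_at_flip.
Qed.

Lemma row_saddle_count (p q i j : nat) (X Y : nat -> nat -> bool) :
  j < q.+1 -> saddle_at p q X Y i j -> 0 < \sum_(k < q.+1) saddle_at p q X Y i k.
Proof.
move=> jq s; have := leq_sum_term (fun k => nat_of_bool (saddle_at p q X Y i k)) jq.
by rewrite s.
Qed.

Lemma saddle_count_gt0 (p q i j : nat) (X Y : nat -> nat -> bool) :
  j < q.+1 -> saddle_at p q X Y i j -> 0 < saddle_count p q X Y.
Proof.
move=> jq s; have ip : i < p.+1 by case/andP: s => /andP[_ /ltnW].
apply: leq_trans (row_saddle_count jq s) _.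
exact: (leq_sum_term (fun i => \sum_(k < q.+1) saddle_at p q X Y i k) ip).
Qed.

Lemma saddle_count_gt1 (p q i i' j j' : nat) (X Y : nat -> nat -> bool) :
  j < q.+1 -> saddle_at p q X Y i j -> j' < q.+1 -> saddle_at p q X Y i' j' ->
  i != i' -> 1 < saddle_count p q X Y.
Proof.
move=> jq s jq' s' ne; have ip : i < p.+1 by case/andP: s => /andP[_ /ltnW].
have ip' : i' < p.+1 by case/andP: s' => /andP[_ /ltnW].
apply: leq_trans (leq_sum_terms (fun i => \sum_(k < q.+1) saddle_at p q X Y i k) ip ip' ne).
exact: leq_add (row_saddle_count jq s) (row_saddle_count jq' s').
Qed.

Lemma defect0_turn (p q a b : nat) (c : bool) (X Y : nat -> nat -> bool) :
    reduced_grid p q X Y -> defect p (flip Y 0) (flip Y q) (row_saddles q Y) = 0 ->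
    a <= b -> b < p -> Y a 0 = c -> Y b 0 = ~~ c ->
  exists i, [/\ a <= i, i.+1 <= b, row_saddles q Y i = 0 /\ row_saddles q Y i.+1 = 0,
    Y i 0 = c & Y i.+1 0 = ~~ c].
Proof.
move=> [p0 q0 f _ w] d ab bp ya yb; have [_ _ _ turn] := defect_eq0 p0 w d.
have [] := @crossing (flip Y 0) (~~ c) a b ab; rewrite /flip ?negbK //.
move=> i [ai ib yi yi1]; exists i; split=> //.
by apply: turn; [exact: leq_ltn_trans bp | rewrite /flip yi yi1; case: (c)].
Qed.

Lemma defect0_sides (p q i : nat) (X Y : nat -> nat -> bool) :
    reduced_grid p q X Y -> defect p (flip Y 0) (flip Y q) (row_saddles q Y) = 0 ->
    i < p -> Y i q = Y i 0.
Proof. by move=> [p0 q0 f _ w] d ip; have [_ _ /(_ i ip)[]] := defect_eq0 p0 w d. Qed.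

Lemma turns_saddle (p q i j : nat) (c : bool) (X Y : nat -> nat -> bool) :
    i.+1 < p -> row_saddles q Y i = 0 -> row_saddles q Y i.+1 = 0 ->
    Y i 0 = c -> Y i.+1 0 = ~~ c ->
    j.+1 < q -> col_saddles p X j = 0 -> col_saddles p X j.+1 = 0 ->
    X 0 j = ~~ c -> X 0 j.+1 = c ->
  exists2 j, j < q.+1 & saddle_at p q X Y i.+1 j.
Proof.
move=> ip s1 s2 y1 y2 jq t1 t2 x1 x2.
apply: (turn_row_saddle ip s1 s2 y1 y2 (leqnSn j) jq).
  by rewrite (col_straight t1) // ltnW.
by rewrite (col_straight t2) // ltnW.
Qed.

(** Every turn of the rows from [c] to [~~ c] crosses the given column turn in a vertex saddle of
    its own, so there is only one such turn. The witness is the first row band of sign [~~ c]; a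
    later band of sign [c] would give a second turn below it. *)
Lemma defect0_threshold (p q j : nat) (c : bool) (X Y : nat -> nat -> bool) :
    reduced_grid p q X Y -> defect p (flip Y 0) (flip Y q) (row_saddles q Y) = 0 ->
    j.+1 < q -> col_saddles p X j = 0 -> col_saddles p X j.+1 = 0 ->
    X 0 j = ~~ c -> X 0 j.+1 = c ->
    Y 0 0 = c -> Y p.-1 0 = ~~ c -> saddle_count p q X Y <= 1 ->
  exists i, threshold p (flip Y 0) (flip Y q) (~~ c) i.
Proof.
move=> g d jq t1 t2 x1 x2 y0 yl sc; have [p0 _ _ _ _] := g.
have pp : p.-1 < p by rewrite prednK.
have ex : exists i, (i < p) && (Y i 0 == ~~ c) by exists p.-1; rewrite pp yl eqxx.
have [i0 /andP[ip /eqP yi0] imin] := ex_minnP ex.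
have below i : i < i0 -> Y i 0 = c.
  move=> h; apply/eqP; have := imin i; rewrite (ltn_trans h ip) /= leqNgt h /=.
  by case: (Y i 0); case: (c) => //= /(_ isT).
exists i0; split=> i hi h; rewrite /flip (defect0_sides g d hi).
  by rewrite below // negbK.
suff -> : Y i 0 = ~~ c by [].
case: (Y i 0 =P ~~ c) => // ne; have yi : Y i 0 = c by move: ne; case: (Y i 0); case: (c).
have [k [_ k2 [k3 k4] k5 k6]] := defect0_turn g d (leq0n i0) ip y0 yi0.
have hi' : i <= p.-1 by rewrite -ltnS prednK.
have [l [l1 l2 [l3 l4] l5 l6]] := defect0_turn g d hi' pp yi yl.
have [a1 a2 a3] := turns_saddle (leq_ltn_trans k2 ip) k3 k4 k5 k6 jq t1 t2 x1 x2.
have [b1 b2 b3] := turns_saddle (leq_ltn_trans l2 pp) l3 l4 l5 l6 jq t1 t2 x1 x2.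
have kl : k.+1 != l.+1 by rewrite ltn_eqF // ltnS (leq_trans k2) // (leq_trans _ l1) // ltnW.
by have := saddle_count_gt1 a2 a3 b2 b3 kl; rewrite ltnNge sc.
Qed.

(** * Grids whose total defect is at most two *)

Definition one_sided (p q : nat) (X Y : nat -> nat -> bool) : Prop :=
  (exists c, forall i j, i < p -> j <= q -> Y i j = c) \/
  (exists c, forall i j, i <= p -> j < q -> X i j = c).

(** With zero defect every saddle column has equal ends, so the leftmost one would show both signs
    on the left side. Hence there is none, and the vertical steps propagate unchanged along the
    rows. *)
Lemma defect0_constant (p q : nat) (X Y : nat -> nat -> bool) :
    reduced_grid p q X Y ->
    defect q (X 0) (X p) (col_saddles p X) = 0 ->
    (forall i, i < p -> Y i 0 = Y 0 0) ->
  exists c, forall i j, i < p -> j <= q -> Y i j = c.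
Proof.
move=> [p0 q0 f w _] d cst; exists (Y 0 0) => i j ip jq.
have [_ _ ev _] := defect_eq0 q0 w d.
rewrite -(cst i ip); apply: (no_col_saddle f ip) => // l _ lj.
have lq := leq_trans lj jq.
apply/eqP/negPn/negP => sl.
have exl : exists k, (k < q) && (col_saddles p X k != 0) by exists l; rewrite lq.
have [m /andP[mq sm] mmin] := ex_minnP exl.
have [] := @leftmost_saddle_column p q m X Y f mq _ sm.
- move=> k km; apply/eqP; apply/negPn/negP => sk; have := mmin k.
  by rewrite sk (ltn_trans km mq) => /(_ isT); rewrite leqNgt km.
- by have [] := ev m mq.
move=> i1 [i2 [h1 h2 e1 e2]]; move: (cst i2 h2); rewrite e2 -(cst i1 (ltn_trans h1 h2)) e1.
by case: (X 0 m).
Qed.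

Lemma nonconstant (p : nat) (f : nat -> bool) :
  (forall i, i < p -> f i = f 0) \/ exists2 i, i < p & f i = ~~ f 0.
Proof.
case: (boolP [forall i : 'I_p, f i == f 0]) => [/forallP h|].
  by left=> i ip; have /eqP := h (Ordinal ip).
rewrite negb_forall => /existsP[i h]; right; exists i => //.
by case: (f i) (f 0) h => [] [].
Qed.

Lemma both_defects_eq0 (p q : nat) (X Y : nat -> nat -> bool) :
    reduced_grid p q X Y ->
    defect q (X 0) (X p) (col_saddles p X) = 0 ->
    defect p (flip Y 0) (flip Y q) (row_saddles q Y) = 0 ->
    corner_extrema p q X Y + 2 * saddle_count p q X Y <= 2 ->
  one_sided p q X Y \/ (p <= 3 /\ q <= 3).
Proof.
move=> g dc dr k; have [p0 q0 f _ _] := g.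
have g' := reduced_grid_flip g.
case: (nonconstant p (flip Y 0)) => [h|[i ip yi]].
  by left; left; exact: (defect0_constant g dc).
case: (nonconstant q (X 0)) => [h|[j jq xj]].
  left; right; have [c hc] := defect0_constant g' dr h.
  by exists c => i' j' h1 h2; exact: (hc j' i').
rewrite /flip in yi.
have pp : p.-1 < p by rewrite prednK.
have qq : q.-1 < q by rewrite prednK.
have [a [_ a2 [a3 a4] a5 a6]] := defect0_turn g dr (leq0n i) ip erefl yi.
have [b [_ b2 [b3 b4] b5 b6]] := defect0_turn g' dc (leq0n j) jq erefl xj.
have ap := leq_ltn_trans a2 ip; have bq := leq_ltn_trans b2 jq.
rewrite -/(col_saddles p X b) -/(col_saddles p X b.+1) /flip in b3 b4 b5 b6.
have yq := defect0_sides g dr; have xq := defect0_sides g' dc.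
rewrite /flip in xq.
have ap1 : a.+1 <= p.-1 by rewrite -ltnS prednK.
have bq1 : b.+1 <= q.-1 by rewrite -ltnS prednK.
have := k; rewrite /corner_extrema xq // xq // yq // yq //.
(* Opposite sides carry equal signs, so the number of extremal corners is even. If the first corner
   is extremal there are at least two, which excludes vertex saddles. Then neither the left nor the
   top side can turn back to its first sign, and all four corners are extremal, too many. *)
case: (X 0 0 =P Y 0 0) => e.
  have sc : saddle_count p q X Y = 0.
    apply/eqP; move: k; rewrite /corner_extrema xq // xq // yq // yq // e eqxx.
    by clear; case: (X 0 q.-1) (Y 0 0) (Y p.-1 0) => [] [] [] /=; lia.
  have no s : ~ exists2 j, j < q.+1 & saddle_at p q X Y s j.
    by case=> u uq /(saddle_count_gt0 uq); rewrite sc.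
  have yl : Y p.-1 0 = ~~ Y 0 0.
    case: (Y p.-1 0 =P ~~ Y 0 0) => // ne.
    have yl : Y p.-1 0 = ~~ ~~ Y 0 0 by move: ne; case: (Y _ _) (Y 0 0) => [] [].
    have [l [l1 l2 [l3 l4] l5 l6]] := defect0_turn g dr ap1 pp a6 yl.
    exfalso; apply: (no l.+1).
    apply: (turns_saddle (leq_ltn_trans l2 pp) l3 l4 l5 l6 bq b3 b4).
      by rewrite b5 e negbK.
    by rewrite b6 e.
  have xl : X 0 q.-1 = ~~ X 0 0.
    case: (X 0 q.-1 =P ~~ X 0 0) => // ne.
    have xl : X 0 q.-1 = ~~ ~~ X 0 0 by move: ne; case: (X 0 q.-1) (X 0 0) => [] [].
    have [l [l1 l2 [l3 l4] l5 l6]] := defect0_turn g' dc bq1 qq b6 xl.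
    exfalso; apply: (no a.+1).
    by apply: (turns_saddle ap a3 a4 a5 a6 (leq_ltn_trans l2 qq) l3 l4); rewrite -e // -[RHS]negbK.
  by rewrite yl xl e; case: (Y 0 0).
(* Here the row turn and the column turn cross in a vertex saddle, which uses up the bound: no
   corner is extremal and there is no second saddle. *)
move=> k'; right.
have xy : X 0 0 = ~~ Y 0 0 by move: e; case: (X 0 0) (Y 0 0) => [] [].
have sc0 : 0 < saddle_count p q X Y.
  have [u uq su] : exists2 u, u < q.+1 & saddle_at p q X Y a.+1 u.
    by apply: (turns_saddle ap a3 a4 a5 a6 bq b3 b4); rewrite ?b5 ?b6 xy ?negbK.
  exact: saddle_count_gt0 uq su.
have [xl yl] : X 0 q.-1 = Y 0 0 /\ Y p.-1 0 = ~~ Y 0 0.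
  move: k'; rewrite xy; clear -sc0.
  by case: (X 0 q.-1) (Y 0 0) (Y p.-1 0) => [] [] [] /=; lia.
have sc1 : saddle_count p q X Y <= 1 by clear -k; lia.
have sc1' : saddle_count q p (flip Y) (flip X) <= 1 by rewrite saddle_count_flip.
have [i0 ti] : exists i, threshold p (flip Y 0) (flip Y q) (~~ Y 0 0) i.
  by apply: (defect0_threshold g dr bq b3 b4) => //; rewrite ?b5 ?b6 xy ?negbK.
have [j0 tj] : exists j, threshold q (X 0) (X p) (~~ ~~ Y 0 0) j.
  by apply: (defect0_threshold g' dc ap a3 a4) => //; rewrite /flip ?a5 ?a6 ?negbK.
by split; [apply: (threshold_cols g' ti tj) | rewrite negbK in tj; apply: (threshold_cols g tj ti)].
Qed.

Lemma band_word_straight (n j : nat) (t b : nat -> bool) (s : nat -> nat) :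
  band_word n t b s -> j < n -> s j = 0 -> t j = b j.
Proof. by move=> [par _] /par + e; rewrite e /=; case: (t j) (b j) => [] []. Qed.

Lemma row_defect0_col_defect0 (p q : nat) (X Y : nat -> nat -> bool) :
    reduced_grid p q X Y ->
    defect p (flip Y 0) (flip Y q) (row_saddles q Y) = 0 ->
    ~~ odd (defect q (X 0) (X p) (col_saddles p X) + corner_extrema p q X Y) ->
    defect q (X 0) (X p) (col_saddles p X) + corner_extrema p q X Y +
      2 * saddle_count p q X Y <= 2 ->
  defect q (X 0) (X p) (col_saddles p X) = 0.
Proof.
move=> g dr par le2; have [p0 q0 f w _] := g.
have pp : p.-1 < p by rewrite prednK.
have qq : q.-1 < q by rewrite prednK.
have yq := defect0_sides g dr.
set dc := defect _ _ _ _ in par le2 *.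
have [//|d1|d2] : [\/ dc = 0, dc = 1 | 2 <= dc].
  by case: dc {par le2} => [|[|dc]]; [constructor 1 | constructor 2 | constructor 3].
  (* Defect 1 leaves the end columns straight, so the number of extremal corners is even, against
     the parity hypothesis. *)
  have [s0 sl _] := defect_eq1 q0 w d1.
  move: le2 par; rewrite d1 /corner_extrema (yq 0) // (yq p.-1) //.
  rewrite (band_word_straight w q0 s0) (band_word_straight w qq sl); clear.
  by case: (X p 0) (X p q.-1) (Y 0 0) (Y p.-1 0) => [] [] [] [] /=; lia.
(* A column defect of 2 exhausts the bound. The absence of extremal corners fixes the signs at the
   corners, and every possibility for the end columns then costs more than 2 or creates a vertex
   saddle. *)
have k0 : corner_extrema p q X Y = 0 by clear -le2 d2; lia.
have sc : saddle_count p q X Y = 0 by clear -le2 d2; lia.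
have no s : ~ exists2 j, j < q.+1 & saddle_at p q X Y s j.
  by case=> u uq /(saddle_count_gt0 uq); rewrite sc.
have dc2 : ~ 2 < dc by clear -le2; lia.
move: k0; rewrite /corner_extrema (yq 0) // (yq p.-1) // => k0.
have [x00 x0l] : X 0 0 = ~~ Y 0 0 /\ X 0 q.-1 = Y 0 0.
  by move: k0; clear; case: (X 0 0) (X 0 q.-1) (Y 0 0) => [] [] [].
have [xp0 xpl] : X p 0 = Y p.-1 0 /\ X p q.-1 = ~~ Y p.-1 0.
  move: k0; clear; case: (X p 0) (X p q.-1) (Y p.-1 0) => [] [] [] /=; lia.
exfalso.
(* If the left side starts and ends with the same sign, both end columns have different signs at top
   and bottom, so both contain saddles. *)
case: (Y p.-1 0 =P Y 0 0) => [e|ne].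
  apply: dc2; apply: (defect_ends q0 w).
    by apply/eqP => /(band_word_straight w q0); rewrite x00 xp0 e; case: (Y 0 0).
  by apply/eqP => /(band_word_straight w qq); rewrite x0l xpl e; case: (Y 0 0).
have yl : Y p.-1 0 = ~~ Y 0 0 by move: ne; case: (Y _ _) (Y 0 0) => [] [].
have [a [_ a2 [a3 a4] a5 a6]] := defect0_turn g dr (leq0n p.-1) pp erefl yl.
have ap := leq_ltn_trans a2 pp.
have cross u v : u <= v -> v < q -> X a.+1 u = ~~ Y 0 0 -> X a.+1 v = Y 0 0 -> False.
  by move=> h1 h2 h3 h4; apply: (no a.+1); exact: (turn_row_saddle ap a3 a4 a5 a6 h1 h2 h3 h4).
have xs j : col_saddles p X j = 0 -> X a.+1 j = X 0 j by move=> h; rewrite (col_straight h) // ltnW.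
case: (col_saddles p X 0 =P 0) => s0; case: (col_saddles p X q.-1 =P 0) => sl.
- by apply: (cross 0 q.-1) => //; rewrite xs.
- apply: dc2; apply: (defect_last q0 w) => //.
  + exact/eqP.
  + by rewrite x0l xpl yl negbK.
  + move=> j jq sj; rewrite x0l; apply/eqP => xj.
    by apply: (cross 0 j) => //; rewrite xs.
- apply: dc2; apply: (defect_first q0 w) => //.
  + exact/eqP.
  + by rewrite x00 xp0 yl.
  + move=> j jq sj; rewrite x00; apply/eqP => xj.
    apply: (cross j q.-1) => //; [|by rewrite xs|by rewrite xs].
    by rewrite -ltnS prednK.
by apply: dc2; apply: (defect_ends q0 w); apply/eqP.
Qed.

(** The corner condition makes the first and last columns straight of signs [~~ Y 0 0] and [Y 0 0],
    so a turn row from [Y 0 0] to [~~ Y 0 0] would contain a vertex saddle. The left side can thus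
    switch this way only at the exceptional band [i0]: induction from the top settles the bands
    before it, induction from the bottom those after it. *)
Lemma defect1_threshold (p q : nat) (X Y : nat -> nat -> bool) :
    reduced_grid p q X Y ->
    defect p (flip Y 0) (flip Y q) (row_saddles q Y) = 1 ->
    col_saddles p X 0 = 0 -> col_saddles p X q.-1 = 0 ->
    corner_extrema p q X Y = 0 -> saddle_count p q X Y = 0 ->
  X 0 0 = ~~ Y 0 0 /\
  exists i, threshold p (flip Y 0) (flip Y q) (~~ Y 0 0) i.
Proof.
move=> g d s0 sl k sc; have [p0 q0 f _ w] := g.
have pp : p.-1 < p by rewrite prednK.
have [r0 rl [i0 [i0p si0 ev turn]]] := defect_eq1 p0 w d.
have x00 : X 0 0 = ~~ Y 0 0.
  by move: k; rewrite /corner_extrema; clear; case: (X 0 0) (Y 0 0) => [] [].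
have xl : X 0 q.-1 = Y 0 0.
  rewrite -(row_straight r0 (leqnn q)); move: k; rewrite /corner_extrema; clear.
  by case: (X 0 q.-1) (Y 0 q) => [] [] /=; lia.
have yl : Y p.-1 0 = ~~ Y 0 0.
  rewrite -x00 -(col_straight s0 (leqnn p)); move: k; rewrite /corner_extrema; clear.
  by case: (X p 0) (Y p.-1 0) => [] [] /=; lia.
have noturn i : i.+1 < p -> i != i0 -> i.+1 != i0 -> Y i 0 = Y 0 0 -> Y i.+1 0 = ~~ Y 0 0 -> False.
  move=> ip n1 n2 y1 y2; have [] := turn i ip n1 n2.
    by rewrite /flip y1 y2; case: (Y 0 0).
  move=> t1 t2; have qq : q.-1 < q by rewrite prednK.
  have h1 : X i.+1 0 = ~~ Y 0 0 by rewrite (col_straight s0) // ltnW.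
  have h2 : X i.+1 q.-1 = Y 0 0 by rewrite (col_straight sl) // ltnW.
  have [u uq su] := turn_row_saddle ip t1 t2 y1 y2 (leq0n q.-1) qq h1 h2.
  by have := saddle_count_gt0 uq su; rewrite sc.
have lo i : i < i0 -> Y i 0 = Y 0 0.
  elim: i => // i IH h; have yi := IH (ltnW h).
  case: (Y i.+1 0 =P Y 0 0) => // ne; exfalso; apply: (@noturn i _ _ _ yi).
  - by clear -h i0p; lia.
  - by clear -h; lia.
  - by clear -h; lia.
  - by move: ne; case: (Y _ _) (Y 0 0) => [] [].
have hi i : i0 < i -> i < p -> Y i 0 = ~~ Y 0 0.
  move=> h1 h2; have [n e] : exists n, p.-1 = i + n by exists (p.-1 - i); clear -h2; lia.
  elim: n i h1 h2 e => [|n IH] i h1 h2 e; first by rewrite addn0 in e; rewrite -e.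
  have y1 : Y i.+1 0 = ~~ Y 0 0 by apply: IH; clear -h1 h2 e; lia.
  case: (Y i 0 =P ~~ Y 0 0) => // ne; exfalso; apply: (@noturn i _ _ _ _ y1).
  - by clear -h2 e; lia.
  - by clear -h1; lia.
  - by clear -h1; lia.
  - by move: ne; case: (Y i 0) (Y 0 0) => [] [].
split=> //; exists i0; split=> i ip h; have [] := ev i ip; rewrite ?negbK.
- by rewrite ltn_eqF.
- by rewrite /flip => <- _; rewrite lo.
- by rewrite gtn_eqF.
by rewrite /flip => <- _; rewrite hi.
Qed.

Theorem reduced_grid_bound (p q : nat) (X Y : nat -> nat -> bool) :
    reduced_grid p q X Y -> ~ one_sided p q X Y ->
    \sum_(i < p.+1) \sum_(j < q.+1)
      (minimum_at p q X Y i j + maximum_at p q X Y i j) = 8 ->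
  \sum_(i < p) (row_saddles q Y i == 0) + \sum_(j < q) (col_saddles p X j == 0) <= 7.
Proof.
move=> g nos d; have [p0 q0 f wc wr] := g; have g' := reduced_grid_flip g.
have := sum_extrema p0 q0 f; rewrite d => E.
have Ec := defectE q0 wc; have Er := defectE p0 wr.
rewrite leqNgt; apply/negP => kl.
have small : ~ (p <= 3 /\ q <= 3).
  move=> [p3 q3]; move: kl; rewrite ltnNge; apply/negP; rewrite negbK.
  apply: (@leq_trans (3 + 3)) => //; apply: leq_add.
    apply: leq_trans p3; rewrite -[X in _ <= X]card_ord -sum1_card; apply: leq_sum => i _.
    by case: eqP.
  apply: leq_trans q3; rewrite -[X in _ <= X]card_ord -sum1_card; apply: leq_sum => i _.
  by case: eqP.
set dc := defect q _ _ _ in Ec; set dr := defect p _ _ _ in Er.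
(* Combining [E], [Ec] and [Er] expresses this sum as 18 minus twice the number of straight bands,
   which gives both the bound and the parity below. If both defects are positive, they equal 1 and
   nothing else remains. *)
have le2 : dc + dr + corner_extrema p q X Y + 2 * saddle_count p q X Y <= 2.
  by move: E Ec Er kl; rewrite /saddle_count /col_saddles /row_saddles; clear; lia.
have par : ~~ odd (dc + dr + corner_extrema p q X Y).
  by move: E Ec Er kl; rewrite /saddle_count /col_saddles /row_saddles; clear; lia.
have caseI : dc = 0 -> dr = 0 -> False.
  move=> c0 r0; have [] // := both_defects_eq0 g c0 r0; first by clear -le2; lia.
case: (posnP dr) => r0.
  apply: (caseI _ r0); apply: (row_defect0_col_defect0 g) => //; rewrite -/dc.
    by rewrite r0 addn0 in par.
  by clear -le2; lia.
case: (posnP dc) => c0.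
  apply: (caseI c0).
  have := row_defect0_col_defect0 g' c0; rewrite corner_extrema_flip saddle_count_flip -/dr.
  apply; first by rewrite c0 in par.
  by clear -le2; lia.
have d1 : dr = 1 by clear -le2 c0 r0; lia.
have e1 : dc = 1 by clear -le2 c0 r0; lia.
have k0 : corner_extrema p q X Y = 0 by clear -le2 c0 r0; lia.
have sc : saddle_count p q X Y = 0 by clear -le2 c0 r0; lia.
have [r1 r2 _] := defect_eq1 p0 wr d1; have [c1 c2 _] := defect_eq1 q0 wc e1.
have [x00 [i ti]] := defect1_threshold g d1 c1 c2 k0 sc.
have [_ [j tj]] : X 0 0 = ~~ Y 0 0 /\ exists j, threshold q (X 0) (X p) (~~ X 0 0) j.
  split=> //; have := defect1_threshold g' e1 r1 r2.
  by rewrite corner_extrema_flip saddle_count_flip => /(_ k0 sc)[].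
rewrite x00 in tj; apply: small; split; first exact: (threshold_cols g' ti tj).
by rewrite negbK in tj; exact: (threshold_cols g tj ti).
Qed.

(** * Labels and duplication of straight bands *)

Definition label := option bool.

(** Bands with saddles all share the label [None]: only straight bands are ever duplicated or
    merged. *)
Definition row_label (q : nat) (Y : nat -> nat -> bool) (i : nat) : label :=
  if row_saddles q Y i == 0 then Some (Y i 0) else None.
Definition col_label (p : nat) (X : nat -> nat -> bool) (j : nat) : label :=
  if col_saddles p X j == 0 then Some (X 0 j) else None.

Definition row_word (p q : nat) (Y : nat -> nat -> bool) : seq label :=
  mkseq (row_label q Y) p.
Definition col_word (p q : nat) (X : nat -> nat -> bool) : seq label :=
  mkseq (col_label p X) q.

Definition minima_on_side (p q : nat) (X Y : nat -> nat -> bool) : Prop :=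
  [\/ forall i j, i <= p -> j <= q -> minimum_at p q X Y i j -> i = 0,
      forall i j, i <= p -> j <= q -> minimum_at p q X Y i j -> i = p,
      forall i j, i <= p -> j <= q -> minimum_at p q X Y i j -> j = 0 |
      forall i j, i <= p -> j <= q -> minimum_at p q X Y i j -> j = q].

Definition remainder_steps (a b p q : nat) (X Y : nat -> nat -> bool) : Prop :=
  [/\ \sum_(i < p.+1) \sum_(j < q.+1) minimum_at p q X Y i j = a,
      \sum_(i < p.+1) \sum_(j < q.+1) maximum_at p q X Y i j = b &
      ~ minima_on_side p q X Y].

Definition same_steps (p q : nat) (X Y X' Y' : nat -> nat -> bool) : Prop :=
  (forall i j, i <= p -> j < q -> X i j = X' i j) /\
  (forall i j, i < p -> j <= q -> Y i j = Y' i j).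

Lemma same_steps_sym (p q : nat) (X Y X' Y' : nat -> nat -> bool) :
  same_steps p q X Y X' Y' -> same_steps p q X' Y' X Y.
Proof. by case=> hx hy; split=> i j h1 h2; rewrite ?hx ?hy. Qed.

Lemma same_minimum (p q : nat) (X Y X' Y' : nat -> nat -> bool) (i j : nat) :
  same_steps p q X Y X' Y' -> i <= p -> j <= q ->
  minimum_at p q X Y i j = minimum_at p q X' Y' i j.
Proof.
case=> hx hy ip jq; rewrite /minimum_at.
congr [&& _, _, _ & _].
- by case: i ip => //= i ip; rewrite hy.
- by case: ltnP => //= h; rewrite hy.
- by case: j jq => //= j jq; rewrite hx.
by case: ltnP => //= h; rewrite hx.
Qed.

Lemma same_maximum (p q : nat) (X Y X' Y' : nat -> nat -> bool) (i j : nat) :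
  same_steps p q X Y X' Y' -> i <= p -> j <= q ->
  maximum_at p q X Y i j = maximum_at p q X' Y' i j.
Proof.
case=> hx hy ip jq; rewrite /maximum_at.
congr [&& _, _, _ & _].
- by case: i ip => //= i ip; rewrite hy.
- by case: ltnP => //= h; rewrite hy.
- by case: j jq => //= j jq; rewrite hx.
by case: ltnP => //= h; rewrite hx.
Qed.

Lemma same_remainder_steps (a b p q : nat) (X Y X' Y' : nat -> nat -> bool) :
  same_steps p q X Y X' Y' -> remainder_steps a b p q X Y -> remainder_steps a b p q X' Y'.
Proof.
move=> h [<- <- s]; split.
- by apply: eq_bigr => i _; apply: eq_bigr => j _; rewrite (same_minimum h) // -ltnS.
- by apply: eq_bigr => i _; apply: eq_bigr => j _; rewrite (same_maximum h) // -ltnS.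
case=> o; apply: s; [constructor 1|constructor 2|constructor 3|constructor 4];
  by move=> i j ip jq; rewrite (same_minimum h) //; exact: o.
Qed.

Lemma eq_changes (n : nat) (f g : nat -> bool) :
  (forall j, j <= n -> f j = g j) -> changes n f = changes n g.
Proof. by move=> h; apply: eq_bigr => j _; rewrite !h // ltnW. Qed.

Lemma same_row_word (p q : nat) (X Y X' Y' : nat -> nat -> bool) :
  same_steps p q X Y X' Y' -> row_word p q Y = row_word p q Y'.
Proof.
case=> _ hy; apply/eq_in_map => i; rewrite mem_iota add0n => /andP[_ ip].
by rewrite /row_label /row_saddles hy // (eq_changes (hy i ^~ ip)).
Qed.

Lemma same_col_word (p q : nat) (X Y X' Y' : nat -> nat -> bool) :
  same_steps p q X Y X' Y' -> col_word p q X = col_word p q X'.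
Proof.
case=> hx _; apply/eq_in_map => j; rewrite mem_iota add0n => /andP[_ jq].
rewrite /col_label /col_saddles hx //.
by rewrite (@eq_changes p (flip X j) (flip X' j)) // => i ip; exact: hx.
Qed.

Lemma minimum_at_flip (p q : nat) (X Y : nat -> nat -> bool) (i j : nat) :
  minimum_at q p (flip Y) (flip X) j i = minimum_at p q X Y i j.
Proof.
rewrite /minimum_at /flip.
case: (_ ==> ~~ X i j.-1); case: (_ ==> X i j); case: (_ ==> ~~ Y i.-1 j);
by case: (_ ==> Y i j).
Qed.

Lemma maximum_at_flip (p q : nat) (X Y : nat -> nat -> bool) (i j : nat) :
  maximum_at q p (flip Y) (flip X) j i = maximum_at p q X Y i j.
Proof.
rewrite /maximum_at /flip.
case: (_ ==> X i j.-1); case: (_ ==> ~~ X i j); case: (_ ==> Y i.-1 j);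
by case: (_ ==> ~~ Y i j).
Qed.

Lemma remainder_steps_flip (a b p q : nat) (X Y : nat -> nat -> bool) :
  remainder_steps a b p q X Y -> remainder_steps a b q p (flip Y) (flip X).
Proof.
case=> <- <- s; split.
- rewrite exchange_big; apply: eq_bigr => i _; apply: eq_bigr => j _.
  by rewrite minimum_at_flip.
- rewrite exchange_big; apply: eq_bigr => i _; apply: eq_bigr => j _.
  by rewrite maximum_at_flip.
case=> o; apply: s; [constructor 3|constructor 4|constructor 1|constructor 2];
  by move=> i j ip jq; rewrite -minimum_at_flip; exact: o.
Qed.

(** * Duplicating a straight row band *)

Definition dup_index (k i : nat) : nat := i - (k < i).

(** The same index map serves rows of cells and row bands: row [k + 1] copies the horizontal steps
    of row [k], and band [k + 1] copies band [k]. *)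
Definition dup_row (k : nat) (X : nat -> nat -> bool) : nat -> nat -> bool :=
  fun i => X (dup_index k i).

Lemma dup_indexL (k i : nat) : i <= k -> dup_index k i = i.
Proof. by rewrite leqNgt /dup_index => /negPf->; rewrite subn0. Qed.

Lemma dup_indexR (k i : nat) : k <= i -> dup_index k i.+1 = i.
Proof. by move=> h; rewrite /dup_index ltnS h subn1. Qed.

(** The new row [k + 1] lies between two vertical steps of the same sign, so it contains no
    extremum; every other cell sees the same four steps as before. *)
Lemma minimum_at_dup (p q k i j : nat) (c : bool) (X Y : nat -> nat -> bool) :
    k < p -> j <= q -> (forall j, j <= q -> Y k j = c) ->
  minimum_at p.+1 q (dup_row k X) (dup_row k Y) i j =
  (i != k.+1) && minimum_at p q X Y (dup_index k i) j.
Proof.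
move=> kp jq yk; rewrite /minimum_at /dup_row.
case: (ltngtP i k.+1) => h /=.
- have -> : i < p.+1 by clear -kp h; lia.
  have -> : dup_index k i < p by rewrite dup_indexL //; clear -kp h; lia.
  by rewrite !dup_indexL //; clear -h; lia.
- case: i h => // i h; have ki : k <= i by exact: ltnW.
  rewrite !(dup_indexR ki) /= (ltnS i.+1).
  by case: i h {ki} => // i h; rewrite dup_indexR.
by rewrite h (ltnS k.+1) kp /= dup_indexL // dup_indexR // yk //; case: (c).
Qed.

Lemma maximum_at_dup (p q k i j : nat) (c : bool) (X Y : nat -> nat -> bool) :
    k < p -> j <= q -> (forall j, j <= q -> Y k j = c) ->
  maximum_at p.+1 q (dup_row k X) (dup_row k Y) i j =
  (i != k.+1) && maximum_at p q X Y (dup_index k i) j.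
Proof.
move=> kp jq yk; rewrite /maximum_at /dup_row.
case: (ltngtP i k.+1) => h /=.
- have -> : i < p.+1 by clear -kp h; lia.
  have -> : dup_index k i < p by rewrite dup_indexL //; clear -kp h; lia.
  by rewrite !dup_indexL //; clear -h; lia.
- case: i h => // i h; have ki : k <= i by exact: ltnW.
  rewrite !(dup_indexR ki) /= (ltnS i.+1).
  by case: i h {ki} => // i h; rewrite dup_indexR.
by rewrite h (ltnS k.+1) kp /= dup_indexL // dup_indexR // yk //; case: (c).
Qed.

Lemma sum_dup (n k : nat) (f g : nat -> nat) : k < n ->
    f k.+1 = 0 -> (forall i, i != k.+1 -> f i = g (dup_index k i)) ->
  \sum_(i < n.+1) f i = \sum_(i < n) g i.
Proof.
move=> kn fk fg; rewrite (bigD1_ord (Ordinal (kn : k.+1 < n.+1))) //= fk add0n.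
apply: eq_bigr => i _; rewrite fg /= 1?eq_sym ?neq_bump //; congr g.
by rewrite /bump; case: (leqP k.+1 i) => h /=; [rewrite dup_indexR // ltnW | rewrite dup_indexL].
Qed.

(** Since [k < p], away from the new row [dup_index k] sends exactly 0 to 0 and exactly [p + 1] to
    [p], so minima keep their membership in each side. *)
Lemma remainder_steps_dup (a b p q k : nat) (c : bool) (X Y : nat -> nat -> bool) :
    k < p -> (forall j, j <= q -> Y k j = c) ->
  remainder_steps a b p.+1 q (dup_row k X) (dup_row k Y) <-> remainder_steps a b p q X Y.
Proof.
move=> kp yk.
have smin : \sum_(i < p.+2) \sum_(j < q.+1) minimum_at p.+1 q (dup_row k X) (dup_row k Y) i j =
    \sum_(i < p.+1) \sum_(j < q.+1) minimum_at p q X Y i j.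
  apply: (@sum_dup p.+1 k
    (fun i => \sum_(j < q.+1) minimum_at p.+1 q (dup_row k X) (dup_row k Y) i j)
    (fun i => \sum_(j < q.+1) minimum_at p q X Y i j)); first exact: ltnW.
    by rewrite big1 // => j _; rewrite (minimum_at_dup _ _ kp _ yk) ?eqxx // -ltnS.
  move=> i ne; apply: eq_bigr => j _.
  by rewrite (minimum_at_dup _ _ kp _ yk) ?ne // -ltnS.
have smax : \sum_(i < p.+2) \sum_(j < q.+1) maximum_at p.+1 q (dup_row k X) (dup_row k Y) i j =
    \sum_(i < p.+1) \sum_(j < q.+1) maximum_at p q X Y i j.
  apply: (@sum_dup p.+1 k
    (fun i => \sum_(j < q.+1) maximum_at p.+1 q (dup_row k X) (dup_row k Y) i j)
    (fun i => \sum_(j < q.+1) maximum_at p q X Y i j)); first exact: ltnW.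
    by rewrite big1 // => j _; rewrite (maximum_at_dup _ _ kp _ yk) ?eqxx // -ltnS.
  move=> i ne; apply: eq_bigr => j _.
  by rewrite (maximum_at_dup _ _ kp _ yk) ?ne // -ltnS.
have min' i j : j <= q -> minimum_at p.+1 q (dup_row k X) (dup_row k Y) i j ->
    i != k.+1 /\ minimum_at p q X Y (dup_index k i) j.
  by move=> jq; rewrite (minimum_at_dup _ _ kp _ yk) // => /andP.
have up i j : i <= p -> j <= q -> minimum_at p q X Y i j ->
    exists i', [/\ i' <= p.+1, dup_index k i' = i, i' != k.+1 &
                  minimum_at p.+1 q (dup_row k X) (dup_row k Y) i' j].
  move=> ip jq m; exists (if i <= k then i else i.+1).
  have e : dup_index k (if i <= k then i else i.+1) = i.
    by case: leqP => h; [exact: dup_indexL | apply: dup_indexR; exact: ltnW].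
  have ne : (if i <= k then i else i.+1) != k.+1.
    by case: leqP => h; [rewrite ltn_eqF | rewrite gtn_eqF].
  by split=> //; [case: ifP; lia | rewrite (minimum_at_dup _ _ kp _ yk) // ne e].
have side : minima_on_side p.+1 q (dup_row k X) (dup_row k Y) <-> minima_on_side p q X Y.
  split=> -[o|o|o|o]; [constructor 1|constructor 2|constructor 3|constructor 4|
                       constructor 1|constructor 2|constructor 3|constructor 4].
  - by move=> i j ip jq /(up i j ip jq)[i' [i'p <- ne m]]; rewrite (o _ _ i'p jq m).
  - move=> i j ip jq /(up i j ip jq)[i' [i'p <- ne m]]; rewrite (o _ _ i'p jq m).
    by rewrite dup_indexR // ltnW.
  - by move=> i j ip jq /(up i j ip jq)[i' [i'p _ ne m]]; rewrite (o _ _ i'p jq m).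
  - by move=> i j ip jq /(up i j ip jq)[i' [i'p _ ne m]]; rewrite (o _ _ i'p jq m).
  - move=> i j ip jq /(min' i j jq)[ne m].
    have := o _ _ _ jq m; rewrite /dup_index; clear -ip kp ne; lia.
  - move=> i j ip jq /(min' i j jq)[ne m].
    have := o _ _ _ jq m; rewrite /dup_index; clear -ip kp ne; lia.
  - move=> i j ip jq /(min' i j jq)[ne m]; apply: (o _ _ _ jq m).
    rewrite /dup_index; clear -ip kp ne; lia.
  - move=> i j ip jq /(min' i j jq)[ne m]; apply: (o _ _ _ jq m).
    rewrite /dup_index; clear -ip kp ne; lia.
by rewrite /remainder_steps smin smax; split=> -[-> -> s]; split=> // /side.
Qed.

Lemma col_word_dup (p q k : nat) (X : nat -> nat -> bool) : k < p ->
  col_word p.+1 q (dup_row k X) = col_word p q X.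
Proof.
move=> kp; apply: eq_map => j; rewrite /col_label /col_saddles {2}/dup_row dup_indexL //.
congr (if _ == 0 then _ else _); rewrite /changes.
rewrite (bigD1_ord (Ordinal (ltnW kp : k < p.+1))) //=.
rewrite {1 2}/flip /dup_row dup_indexL // dup_indexR // addbb add0n.
apply: eq_bigr => i _; rewrite /flip /= /bump.
case: (leqP k i) => h; first by rewrite add1n !dup_indexR // ltnW.
by rewrite add0n !dup_indexL // ltnW.
Qed.

Lemma row_word_dup (p q k : nat) (c : bool) (Y : nat -> nat -> bool) (u v : seq label) :
    k < p -> k = size u ->
  row_word p.+1 q (dup_row k Y) = u ++ [:: Some c, Some c & v] <->
  row_word p q Y = u ++ Some c :: v.
Proof.
move=> kp ku.
have -> : row_word p.+1 q (dup_row k Y) =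
    take k.+1 (row_word p q Y) ++ drop k (row_word p q Y).
  apply: (@eq_from_nth _ None).
    rewrite size_cat size_take size_drop !size_mkseq; case: ltnP => h; clear -h kp; lia.
  move=> i; rewrite size_mkseq => ip; rewrite nth_mkseq // nth_cat size_take size_mkseq.
  have e : (if k.+1 < p then k.+1 else p) = k.+1 by case: ltnP => h; clear -h kp; lia.
  rewrite e nth_drop.
  case: ltnP => h.
    rewrite nth_take // nth_mkseq /=; last by clear -h kp; lia.
    by rewrite /row_label /row_saddles /dup_row dup_indexL.
  have i0 : k + (i - k.+1) = i.-1 by clear -h; lia.
  rewrite i0 nth_mkseq; last by clear -h ip; lia.
  by case: i h {ip i0} => // i h; rewrite /row_label /row_saddles /dup_row dup_indexR.
set W := row_word p q Y; have sW : size W = p by rewrite size_mkseq.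
split=> [e|->]; last first.
  by rewrite ku take_cat drop_cat !ltnNge leqnn leqnSn subnn subSnn /= take0 -catA.
have e1 : take k.+1 W = rcons u (Some c).
  have := congr1 (take k.+1) e; rewrite take_size_cat ?size_takel ?sW // => ->.
  by rewrite -cat_rcons take_size_cat // size_rcons ku.
have := congr1 (drop k.+1) e; rewrite drop_size_cat ?size_takel ?sW //.
rewrite -cat_rcons drop_size_cat ?size_rcons ?ku // => e2.
rewrite -[W](cat_take_drop (size u)) e2; congr (_ ++ _).
have := congr1 (take (size u)) e1; rewrite -cats1 take_size_cat // take_takel ?ku ?leqnSn //.
Qed.

(** * Reduced words and the bounds on their lengths *)

Fixpoint reduced (w : seq label) : bool :=
  if w is a :: w' then (isSome a ==> (ohead w' != Some a)) && reduced w' else true.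

Lemma reduced_nth (w : seq label) (i : nat) (c : bool) :
  reduced w -> nth None w i = Some c -> nth None w i.+1 <> Some c.
Proof.
elim: w i => [|a w IH] [|i] //=.
  move=> /andP[h _] ea; rewrite ea in h; case: w {IH} h => //= x w h e.
  by rewrite e eqxx in h.
by move=> /andP[_ /IH]; apply.
Qed.

Lemma count_mkseq (a : pred label) (f : nat -> label) (n : nat) :
  count a (mkseq f n) = \sum_(i < n) a (f i).
Proof.
elim: n => [|n IH]; first by rewrite big_ord0.
by rewrite big_ord_recr -IH mkseqS -cats1 count_cat /= addn0.
Qed.

Lemma row_word_straight (p q : nat) (Y : nat -> nat -> bool) :
  count isSome (row_word p q Y) = \sum_(i < p) (row_saddles q Y i == 0).
Proof.
by rewrite count_mkseq; apply: eq_bigr => i _; rewrite /row_label; case: eqP.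
Qed.

Lemma col_word_straight (p q : nat) (X : nat -> nat -> bool) :
  count isSome (col_word p q X) = \sum_(j < q) (col_saddles p X j == 0).
Proof.
by rewrite count_mkseq; apply: eq_bigr => i _; rewrite /col_label; case: eqP.
Qed.

Lemma reduced_words_grid (p q : nat) (X Y : nat -> nat -> bool) :
    0 < p -> 0 < q -> face_rule p q X Y ->
    reduced (row_word p q Y) -> reduced (col_word p q X) ->
  reduced_grid p q X Y.
Proof.
move=> p0 q0 f rr rc; split=> //; split=> [j jq|j jq s s'].
- by rewrite /col_saddles odd_changes.
- apply/eqP => e; have := @reduced_nth _ j (X 0 j) rc.
  rewrite !nth_mkseq ?(ltnW jq) // /col_label s s' /= => /(_ erefl); apply.
  by rewrite e.
- by rewrite /row_saddles odd_changes.
apply/eqP => e; have := @reduced_nth _ j (Y j 0) rr.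
rewrite !nth_mkseq ?(ltnW jq) // /row_label s s' /= => /(_ erefl); apply.
by rewrite [Y j 0]e.
Qed.

Lemma one_sided_minima (p q : nat) (X Y : nat -> nat -> bool) :
  0 < p -> 0 < q -> one_sided p q X Y -> minima_on_side p q X Y.
Proof.
move=> p0 q0 [[[] h]|[[] h]].
- constructor 1 => i j ip jq /and4P[m _ _ _].
  by case: i ip m => //= i ip; rewrite h.
- constructor 2 => i j ip jq /and4P[_ m _ _].
  move: ip m; rewrite leq_eqVlt => /orP[/eqP//|ip]; by rewrite ip h.
- constructor 3 => i j ip jq /and4P[_ _ m _].
  by case: j jq m => //= j jq; rewrite h.
constructor 4 => i j ip jq /and4P[_ _ _ m].
move: jq m; rewrite leq_eqVlt => /orP[/eqP//|jq]; by rewrite jq h.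
Qed.

Lemma sum_saddles_exchange (p q : nat) (X Y : nat -> nat -> bool) : face_rule p q X Y ->
  \sum_(j < q) col_saddles p X j = \sum_(i < p) row_saddles q Y i.
Proof.
move=> f; rewrite exchange_big; apply: eq_bigr => i _; apply: eq_bigr => j _ /=.
by have [<- _] := f i j (ltn_ord i) (ltn_ord j).
Qed.

Lemma sum_straight (n : nat) (s : nat -> nat) :
  n <= \sum_(i < n) (s i == 0) + \sum_(i < n) s i.
Proof.
rewrite -big_split /= -[X in X <= _]card_ord -sum1_card.
by apply: leq_sum => i _; case: eqP => //=; lia.
Qed.

(** The 7 in the length bounds is the largest number of face saddles that the Morse formula allows
    with 8 extrema; each band that is not straight contains at least one. *)
Lemma remainder_words_bound (a b p q : nat) (X Y : nat -> nat -> bool) :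
    0 < p -> 0 < q -> a + b = 8 -> face_rule p q X Y -> remainder_steps a b p q X Y ->
    reduced (row_word p q Y) -> reduced (col_word p q X) ->
  [/\ count isSome (row_word p q Y) + count isSome (col_word p q X) <= 7,
      p <= count isSome (row_word p q Y) + 7 &
      q <= count isSome (col_word p q X) + 7].
Proof.
move=> p0 q0 ab f [sa sb side] rr rc.
have g := reduced_words_grid p0 q0 f rr rc.
have d : \sum_(i < p.+1) \sum_(j < q.+1)
    (minimum_at p q X Y i j + maximum_at p q X Y i j) = 8.
  by rewrite -ab -sa -sb -big_split; apply: eq_bigr => i _; rewrite -big_split.
have E := sum_extrema p0 q0 f; rewrite d in E.
have B := reduced_grid_bound g (fun h => side (one_sided_minima p0 q0 h)) d.
have ex := sum_saddles_exchange f.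
have rs := sum_straight p (row_saddles q Y); have cs := sum_straight q (col_saddles p X).
rewrite row_word_straight col_word_straight.
move: B E ex rs cs; rewrite /saddle_count /col_saddles /row_saddles; clear => *; split; lia.
Qed.

(** * Height functions as step patterns *)

Definition hstep (H : nat -> nat -> int) (i j : nat) : bool := H i j.+1 == (H i j + 1)%R.
Definition vstep (H : nat -> nat -> int) (i j : nat) : bool := H i.+1 j == (H i j + 1)%R.

Definition height_on (p q : nat) (H : nat -> nat -> int) : Prop :=
  [/\ H 0 0 = 0%R,
      forall i j, i <= p -> j < q -> (`|H i j.+1 - H i j| = 1)%R &
      forall i j, i < p -> j <= q -> (`|H i.+1 j - H i j| = 1)%R].

Definition step (c : bool) : int := if c then 1%R else (-1)%R.

Lemma stepP (x y : int) : (`|y - x| = 1)%R -> (y = x + step (y == x + 1))%R.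
Proof. by rewrite /step; case: eqP => h; lia. Qed.

Lemma height_face_rule (p q : nat) (H : nat -> nat -> int) :
  height_on p q H -> face_rule p q (hstep H) (vstep H).
Proof.
case=> _ hh hv i j ip jq.
have := stepP (hh i j (ltnW ip) jq); have := stepP (hh i.+1 j ip jq).
have := stepP (hv i j ip (ltnW jq)); have := stepP (hv i j.+1 ip jq).
rewrite -/(hstep H i j) -/(hstep H i.+1 j) -/(vstep H i j) -/(vstep H i j.+1).
case: (hstep H i j) (hstep H i.+1 j) (vstep H i j) (vstep H i j.+1) => [] [] [] [];
rewrite /step /=; clear; move=> *; split=> //; lia.
Qed.

(** [inord] sends indices outside the grid to 0, so the values there are meaningless and statements
    are restricted to the grid. *)
Definition nat_height (p q : nat) (h : {ffun cell p.+1 q.+1 -> int}) : nat -> nat -> int :=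
  fun i j => h (inord i, inord j).

Definition cell_height (p q : nat) (H : nat -> nat -> int) : {ffun cell p.+1 q.+1 -> int} :=
  [ffun u : cell p.+1 q.+1 => H u.1 u.2].

Lemma nat_heightK (p q : nat) (h : {ffun cell p.+1 q.+1 -> int}) (u : cell p.+1 q.+1) :
  h u = nat_height h u.1 u.2.
Proof. by rewrite /nat_height !inord_val; case: u. Qed.

Lemma cell_heightK (p q : nat) (H : nat -> nat -> int) (i j : nat) :
  i <= p -> j <= q -> nat_height (cell_height p q H) i j = H i j.
Proof. by move=> ip jq; rewrite /nat_height ffunE /= !inordK. Qed.

Lemma forall_adjacent (p q : nat) (u : cell p.+1 q.+1) (P : nat -> nat -> bool) :
  [forall v : cell p.+1 q.+1, adjacent u v ==> P v.1 v.2] =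
  [&& (0 < u.1) ==> P u.1.-1 u.2, (u.1 < p) ==> P u.1.+1 u.2,
      (0 < u.2) ==> P u.1 u.2.-1 & (u.2 < q) ==> P u.1 u.2.+1].
Proof.
case: u => [[i ip] [j jq]] /=; apply/forallP/and4P => [h|[h1 h2 h3 h4] [[i' ip'] [j' jq']]].
  split; apply/implyP => lt.
  - have := h (inord i.-1, Ordinal jq); rewrite /adjacent /succ_or_pred /= inordK; last lia.
    by rewrite prednK // !eqxx !orbT.
  - have := h (inord i.+1, Ordinal jq); rewrite /adjacent /succ_or_pred /= inordK; last lia.
    by rewrite !eqxx !orbT.
  - have := h (Ordinal ip, inord j.-1); rewrite /adjacent /succ_or_pred /= inordK; last lia.
    by rewrite prednK // !eqxx !orbT.
  - have := h (Ordinal ip, inord j.+1); rewrite /adjacent /succ_or_pred /= inordK; last lia.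
    by rewrite !eqxx.
apply/implyP; rewrite /adjacent /succ_or_pred /= -!val_eqE /=.
case/orP => /andP[/eqP e /orP[/eqP e'|/eqP e']]; subst.
- by apply: (implyP h4).
- by apply: (implyP h3).
- by apply: (implyP h2).
by apply: (implyP h1).
Qed.

Lemma is_heightP (p q : nat) (h : {ffun cell p.+1 q.+1 -> int}) :
  is_height h <-> height_on p q (nat_height h).
Proof.
pose H := nat_height h.
have e u : [forall v, adjacent u v ==> (`|h u - h v| == 1)%R] =
    [forall v : cell p.+1 q.+1, adjacent u v ==> (`|H u.1 u.2 - H v.1 v.2| == 1)%R].
  by apply: eq_forallb => v; rewrite /H -!nat_heightK.
have e2 u : [forall v, adjacent u v ==> (`|h u - h v| == 1)%R] = _ :=
  etrans (e u) (forall_adjacent u (fun i j => (`|H u.1 u.2 - H i j| == 1)%R)).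
split.
  move=> /andP[/forallP a /forallP z]; split.
  - by have /implyP := z (inord 0, inord 0); rewrite !inordK // => /(_ isT)/eqP.
  - move=> i j ip jq; have := a (inord i, inord j).
    rewrite e2 /= !inordK //; [|lia] => /and4P[_ _ _ /implyP/(_ jq)/eqP].
    by rewrite distrC.
  - move=> i j ip jq; have := a (inord i, inord j).
    rewrite e2 /= !inordK //; [|lia] => /and4P[_ /implyP/(_ ip)/eqP + _ _].
    by rewrite distrC.
move=> [z hh hv]; apply/andP; split; apply/forallP => u; last first.
  by apply/implyP => /andP[/eqP u1 /eqP u2]; rewrite nat_heightK u1 u2 z.
rewrite e2; case: u => [[i ip] [j jq]] /=; apply/and4P; split; apply/implyP => lt.
- by case: i ip lt => // i ip _; rewrite hv.
- by rewrite distrC hv.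
- by case: j jq lt => // j jq _; rewrite hh.
by rewrite distrC hh.
Qed.

Lemma local_minimaE (p q : nat) (h : {ffun cell p.+1 q.+1 -> int}) (u : cell p.+1 q.+1) :
  height_on p q (nat_height h) ->
  (u \in local_minima h) = minimum_at p q (hstep (nat_height h)) (vstep (nat_height h)) u.1 u.2.
Proof.
set H := nat_height h; case=> _ hh hv; rewrite inE.
transitivity [forall v : cell p.+1 q.+1, adjacent u v ==> (H v.1 v.2 == H u.1 u.2 + 1)%R].
  by apply: eq_forallb => v; rewrite /H -!nat_heightK.
rewrite (forall_adjacent u (fun i j => H i j == H u.1 u.2 + 1)%R) /minimum_at.
case: u => [[i ip] [j jq]] /=; congr [&& _, _, _ & _].
- case: i ip => //= i ip; have := hv i j ip jq; rewrite /vstep; clear; lia.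
case: j jq => //= j jq; have := hh i j ip jq; rewrite /hstep; clear; lia.
Qed.

Lemma local_maximaE (p q : nat) (h : {ffun cell p.+1 q.+1 -> int}) (u : cell p.+1 q.+1) :
  height_on p q (nat_height h) ->
  (u \in local_maxima h) = maximum_at p q (hstep (nat_height h)) (vstep (nat_height h)) u.1 u.2.
Proof.
set H := nat_height h; case=> _ hh hv; rewrite inE.
transitivity [forall v : cell p.+1 q.+1, adjacent u v ==> (H v.1 v.2 == H u.1 u.2 - 1)%R].
  by apply: eq_forallb => v; rewrite /H -!nat_heightK.
rewrite (forall_adjacent u (fun i j => H i j == H u.1 u.2 - 1)%R) /maximum_at.
case: u => [[i ip] [j jq]] /=; congr [&& _, _, _ & _].
- case: i ip => //= i ip; have := hv i j ip jq; rewrite /vstep; clear; lia.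
- case: ltnP => //= lt; have := hv i j lt jq; rewrite /vstep; clear; lia.
- case: j jq => //= j jq; have := hh i j ip jq; rewrite /hstep; clear; lia.
case: ltnP => //= lt; have := hh i j ip lt; rewrite /hstep; clear; lia.
Qed.

Lemma card_cells (p q : nat) (A : {set cell p.+1 q.+1}) (f : nat -> nat -> bool) :
  (forall u, (u \in A) = f u.1 u.2) -> #|A| = \sum_(i < p.+1) \sum_(j < q.+1) f i j.
Proof.
move=> h; rewrite -sum1_card big_mkcond pair_bigA /=.
by apply: eq_bigr => u _; rewrite h; case: (f _ _).
Qed.

Lemma remainder_heightP (a b p q : nat) (h : {ffun cell p.+1 q.+1 -> int}) :
  remainder_height a b h <->
  height_on p q (nat_height h) /\
  remainder_steps a b p q (hstep (nat_height h)) (vstep (nat_height h)).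
Proof.
set X := hstep _; set Y := vstep _.
have side : height_on p q (nat_height h) ->
    on_single_side (local_minima h) <-> minima_on_side p q X Y.
  move=> hon; have sub (B : {set cell p.+1 q.+1}) (R : nat -> nat -> Prop) :
      (forall u, u \in B <-> R u.1 u.2) ->
      (local_minima h \subset B) <->
      (forall i j, i <= p -> j <= q -> minimum_at p q X Y i j -> R i j).
    move=> hB; split=> [/fintype.subsetP s i j ip jq m|s].
      have := s (inord i, inord j); rewrite local_minimaE //= !inordK // => /(_ m)/hB.
      by rewrite /= !inordK.
    apply/fintype.subsetP => u; rewrite local_minimaE // => m; apply/hB.
    by apply: (s u.1 u.2) => //; rewrite -ltnS ltn_ord.
  have st := sub (top_row p.+1 q.+1) (fun i _ => i = 0)
    ltac:(by move=> u; rewrite inE ?eqSS; split=> [/eqP|->]).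
  have sb := sub (bottom_row p.+1 q.+1) (fun i _ => i = p)
    ltac:(by move=> u; rewrite inE ?eqSS; split=> [/eqP|->]).
  have sl := sub (left_column p.+1 q.+1) (fun _ j => j = 0)
    ltac:(by move=> u; rewrite inE ?eqSS; split=> [/eqP|->]).
  have sr := sub (right_column p.+1 q.+1) (fun _ j => j = q)
    ltac:(by move=> u; rewrite inE ?eqSS; split=> [/eqP|->]).
  rewrite /on_single_side /minima_on_side; split.
    by case/or4P => [/st|/sb|/sl|/sr]; [constructor 1|constructor 2|constructor 3|constructor 4].
  by case=> [/st|/sb|/sl|/sr] ->; rewrite ?orbT.
split.
  case/and4P => /is_heightP hon /eqP ca /eqP cb s; split=> //; split.
  - by rewrite -ca; apply/esym/card_cells => u; exact: local_minimaE.
  - by rewrite -cb; apply/esym/card_cells => u; exact: local_maximaE.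
  by move=> /(side hon); exact/negP.
case=> hon [ca cb s]; apply/and4P; split.
- exact/is_heightP.
- by rewrite -ca; apply/eqP/card_cells => u; exact: local_minimaE.
- by rewrite -cb; apply/eqP/card_cells => u; exact: local_maximaE.
by apply/negP => /(side hon).
Qed.

(** * Counting height functions with given labels *)

Definition labelled_height (a b p q : nat) (w w' : seq label) (H : nat -> nat -> int) : Prop :=
  [/\ height_on p q H, remainder_steps a b p q (hstep H) (vstep H),
      row_word p q (vstep H) = w & col_word p q (hstep H) = w'].

Definition labelled_count (a b p q : nat) (w w' : seq label) : nat :=
  #|` fset_set [set h : {ffun cell p.+1 q.+1 -> int} |
                 labelled_height a b p q w w' (nat_height h)]%classic|%fset.

Definition agree (p q : nat) (G H : nat -> nat -> int) : Prop :=
  forall i j, i <= p -> j <= q -> G i j = H i j.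

Lemma agree_steps (p q : nat) (G H : nat -> nat -> int) :
  agree p q G H -> same_steps p q (hstep G) (vstep G) (hstep H) (vstep H).
Proof.
move=> e; split=> i j ip jq; rewrite /hstep /vstep.
  by rewrite !e // ltnW.
by rewrite !e // ltnW.
Qed.

Lemma agree_height_on (p q : nat) (G H : nat -> nat -> int) :
  agree p q G H -> height_on p q G -> height_on p q H.
Proof.
move=> e [z hh hv]; split; first by rewrite -e.
  by move=> i j ip jq; rewrite -!e ?hh // ltnW.
by move=> i j ip jq; rewrite -!e ?hv // ltnW.
Qed.

Lemma agree_labelled (a b p q : nat) (w w' : seq label) (G H : nat -> nat -> int) :
  agree p q G H -> labelled_height a b p q w w' G -> labelled_height a b p q w w' H.
Proof.
move=> e [h r <- <-]; have s := agree_steps e; split.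
- exact: agree_height_on e h.
- exact: same_remainder_steps s r.
- by rewrite (same_row_word s).
by rewrite (same_col_word s).
Qed.

Lemma finite_labelled (a b p q : nat) (w w' : seq label) :
  finite_set [set h : {ffun cell p.+1 q.+1 -> int} |
                 labelled_height a b p q w w' (nat_height h)]%classic.
Proof.
apply: sub_finite_set (finite_remainder_height a b p.+1 q.+1) => h [h1 h2 _ _] /=.
by apply/remainder_heightP.
Qed.

Lemma labelled_count_le (a b p q p' q' : nat) (w1 w2 w1' w2' : seq label)
    (F : (nat -> nat -> int) -> nat -> nat -> int) :
    (forall H, labelled_height a b p q w1 w2 H -> labelled_height a b p' q' w1' w2' (F H)) ->
    (forall G H, labelled_height a b p q w1 w2 G -> labelled_height a b p q w1 w2 H ->
       agree p' q' (F G) (F H) -> agree p q G H) ->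
  labelled_count a b p q w1 w2 <= labelled_count a b p' q' w1' w2'.
Proof.
move=> mapF injF; rewrite /labelled_count.
set A := fset_set _; set B := fset_set _.
pose f (h : {ffun cell p.+1 q.+1 -> int}) := cell_height p' q' (F (nat_height h)).
have memA h : h \in A -> labelled_height a b p q w1 w2 (nat_height h).
  by rewrite in_fset_set ?inE //; exact: finite_labelled.
have /card_in_imfsetP/eqP <- : {in A &, injective f}.
  move=> g h /memA lg /memA lh e; apply/ffunP => u.
  rewrite !nat_heightK; apply: (injF _ _ lg lh); rewrite -1?ltnS // => i j ip jq.
  by have := congr1 (fun h => nat_height h i j) e; rewrite !cell_heightK.
apply/fsubset_leq_card/fsubsetP => _ /imfsetP[h /= /memA lh ->].
rewrite in_fset_set; last exact: finite_labelled.
rewrite inE /=; apply: agree_labelled (mapF _ lh) => i j ip jq.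
by rewrite cell_heightK.
Qed.

(** Row [k + 1] becomes row [k] shifted by [step c], and all later rows are shifted by the same
    amount, so the other steps are preserved. *)
Definition ins_row (k : nat) (c : bool) (H : nat -> nat -> int) (i j : nat) : int :=
  if i <= k then H i j else (H i.-1 j + step c)%R.

Definition del_row (k : nat) (c : bool) (H : nat -> nat -> int) (i j : nat) : int :=
  if i <= k then H i j else (H i.+1 j - step c)%R.

Lemma ins_row_height (p q k : nat) (c : bool) (H : nat -> nat -> int) :
    height_on p q H -> k < p ->
  height_on p.+1 q (ins_row k c H).
Proof.
move=> [z hh hv] kp; split=> [|i j ip jq|i j ip jq]; rewrite /ins_row.
- by rewrite leq0n.
- case: leqP => h; first by apply: hh; lia.
  by rewrite opprD addrACA subrr addr0; apply: hh; lia.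
case: (ltngtP i k) => h.
- by apply: hv; lia.
- by case: i h ip => // i h ip; rewrite opprD addrACA subrr addr0; apply: hv; lia.
by rewrite h /= addrAC subrr add0r; case: (c).
Qed.

Lemma ins_row_steps (p q k : nat) (c : bool) (H : nat -> nat -> int) :
    (forall j, j <= q -> vstep H k j = c) ->
  same_steps p.+1 q (dup_row k (hstep H)) (dup_row k (vstep H))
                  (hstep (ins_row k c H)) (vstep (ins_row k c H)).
Proof.
move=> hk; split=> i j ip jq; rewrite /dup_row /hstep /vstep /ins_row.
  case: leqP => h; first by rewrite dup_indexL.
  case: i h {ip} => // i h; rewrite dup_indexR //=.
  by rewrite addrAC (inj_eq (addIr _)).
case: (ltngtP i k) => h.
- by rewrite dup_indexL // ltnW.
- case: i h {ip} => // i h; rewrite dup_indexR //=.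
  by rewrite addrAC (inj_eq (addIr _)).
rewrite h dup_indexL // -/(vstep H k j) hk //=.
by rewrite (inj_eq (addrI _)); case: (c).
Qed.

Lemma row_word_nth (p q : nat) (c : bool) (Y : nat -> nat -> bool) (u v : seq label) :
    row_word p q Y = u ++ Some c :: v ->
  size u < p /\ forall j, j <= q -> Y (size u) j = c.
Proof.
move=> e; have up : size u < p.
  by rewrite -(size_mkseq (row_label q Y) p) -/(row_word p q Y) e size_cat /= addnS ltnS leq_addr.
split=> // j jq; have := congr1 (fun s => nth None s (size u)) e.
rewrite nth_mkseq // nth_cat ltnn subnn /= /row_label.
by case: eqP => // s [] <-; rewrite (row_straight s).
Qed.

Lemma labelled_ins (a b p q : nat) (c : bool) (u v w' : seq label) (H : nat -> nat -> int) :
    labelled_height a b p q (u ++ Some c :: v) w' H ->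
  labelled_height a b p.+1 q (u ++ [:: Some c, Some c & v]) w' (ins_row (size u) c H).
Proof.
move=> [ho r rw cw]; have [kp hk] := row_word_nth rw.
have s := ins_row_steps p hk; split.
- exact: ins_row_height.
- by apply: (same_remainder_steps s); apply/(remainder_steps_dup _ _ _ kp hk).
- by rewrite -(same_row_word s); apply/(row_word_dup _ _ _ _ kp erefl).
by rewrite -(same_col_word s) col_word_dup.
Qed.

Lemma del_rowK (a b p q : nat) (c : bool) (u v w' : seq label) (H : nat -> nat -> int) :
    labelled_height a b p.+1 q (u ++ [:: Some c, Some c & v]) w' H ->
  agree p.+1 q (ins_row (size u) c (del_row (size u) c H)) H.
Proof.
move=> [[z hh hv] r rw cw]; have [kp hk] := row_word_nth rw.
move=> i j ip jq; rewrite /ins_row /del_row.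
case: (leqP i (size u)) => [//|h]; case: i h ip => // i h ip /=.
case: ltngtP => h'; first by lia.
  by rewrite subrK.
by rewrite h' (stepP (hv (size u) j kp jq)) -/(vstep H _ _) hk.
Qed.

(** Reinserting the deleted row gives back [H] on the grid, so the steps of [H] are the duplicated
    steps of the shorter function, and the duplication equivalences apply backwards. *)
Lemma labelled_del (a b p q : nat) (c : bool) (u v w' : seq label) (H : nat -> nat -> int) :
    labelled_height a b p.+1 q (u ++ [:: Some c, Some c & v]) w' H ->
  labelled_height a b p q (u ++ Some c :: v) w' (del_row (size u) c H).
Proof.
move=> lab; have back := del_rowK lab.
have [ho r rw cw] := lab; have [kp hk] := row_word_nth rw.
have rw' : row_word p.+1 q (vstep H) = rcons u (Some c) ++ Some c :: v by rewrite cat_rcons.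
have [kp' hk'] := row_word_nth rw'; rewrite size_rcons in kp' hk'.
have [z hh hv] := ho.
have e1 j : j <= q -> H (size u).+1 j = (H (size u) j + step c)%R.
  by move=> jq; rewrite (stepP (hv (size u) j kp jq)) -/(vstep H _ _) hk.
have e2 j : j <= q -> H (size u).+2 j = (H (size u).+1 j + step c)%R.
  by move=> jq; rewrite (stepP (hv (size u).+1 j kp' jq)) -/(vstep H _ _) hk'.
have dk j : j <= q -> vstep (del_row (size u) c H) (size u) j = c.
  move=> jq; rewrite /vstep /del_row leqnn ltnn e2 // addrK e1 //.
  by rewrite (inj_eq (addrI _)); case: (c).
have dh : height_on p q (del_row (size u) c H).
  split=> [|i j ip jq|i j ip jq]; rewrite /del_row.
  - by rewrite leq0n.
  - case: leqP => h; first by apply: hh; lia.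
    by rewrite opprB addrA subrK; apply: hh; lia.
  case: (ltngtP i (size u)) => h.
  - by apply: hv; lia.
  - by rewrite opprB addrA subrK; apply: hv; lia.
  by rewrite h e2 // addrK; apply: hv; lia.
have s := same_steps_sym (ins_row_steps p dk); have s' := same_steps_sym (agree_steps back).
split=> //.
- apply/(remainder_steps_dup _ _ _ (kp' : size u < p) dk).
  exact: same_remainder_steps s (same_remainder_steps s' r).
- apply/(row_word_dup _ _ _ _ (kp' : size u < p) erefl).
  by rewrite -(same_row_word s) -(same_row_word s').
by rewrite -(@col_word_dup _ _ (size u)) // -(same_col_word s) -(same_col_word s').
Qed.

Lemma labelled_count_dup (a b p q : nat) (c : bool) (u v w' : seq label) :
  labelled_count a b p.+1 q (u ++ [:: Some c, Some c & v]) w' =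
  labelled_count a b p q (u ++ Some c :: v) w'.
Proof.
apply/eqP; rewrite eqn_leq; apply/andP; split.
  apply: (@labelled_count_le _ _ _ _ _ _ _ _ _ _ (del_row (size u) c)).
    exact: labelled_del.
  move=> G H lG lH e i j ip jq.
  have kp : size u < p.+1 by case: lG => _ _ /row_word_nth[].
  rewrite -(del_rowK lG) // -(del_rowK lH) // /ins_row.
  by case: leqP => h; rewrite e //; clear -h ip kp; lia.
apply: (@labelled_count_le _ _ _ _ _ _ _ _ _ _ (ins_row (size u) c)).
  exact: labelled_ins.
move=> G H _ _ e i j ip jq; case: (leqP i (size u)) => h.
  by have := e i j (leqW ip) jq; rewrite /ins_row h.
by have := e i.+1 j ip jq; rewrite /ins_row ltnNge (ltnW h) /=; exact: addIr.
Qed.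

Lemma labelled_flip (a b p q : nat) (w w' : seq label) (H : nat -> nat -> int) :
  labelled_height a b p q w w' H -> labelled_height a b q p w' w (fun i j => H j i).
Proof.
move=> [[z hh hv] r rw cw]; split=> //.
- by split=> // i j ip jq; [exact: hv | exact: hh].
exact: remainder_steps_flip.
Qed.

Lemma labelled_count_flip (a b p q : nat) (w w' : seq label) :
  labelled_count a b p q w w' = labelled_count a b q p w' w.
Proof.
apply/eqP; rewrite eqn_leq; apply/andP; split;
  apply: (@labelled_count_le _ _ _ _ _ _ _ _ _ _ (fun H i j => H j i));
  by [exact: labelled_flip | move=> G H _ _ e i j ip jq; exact: e].
Qed.

(** * Reduction of words and the partition of the remainder by words *)

Fixpoint reduce (w : seq label) : seq label :=
  if w is a :: w' then
    if isSome a && (ohead (reduce w') == Some a) then reduce w' else a :: reduce w'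
  else [::].

Lemma reduce_reduced (w : seq label) : reduced (reduce w).
Proof.
elim: w => //= a w IH; case: ifP => //= h; rewrite IH andbT.
by apply/implyP => sa; rewrite sa /= in h; rewrite h.
Qed.

Lemma labelled_count_reduce (a b q : nat) (w w' : seq label) :
  labelled_count a b (size w) q w w' = labelled_count a b (size (reduce w)) q (reduce w) w'.
Proof.
(* [reduce] works from the right, so a letter is merged while the prefix [u] to its left is still
   unreduced. *)
have gen u : labelled_count a b (size (u ++ w)) q (u ++ w) w' =
             labelled_count a b (size (u ++ reduce w)) q (u ++ reduce w) w'.
  elim: w u => // x w IH u; rewrite -cat_rcons IH cat_rcons /=.
  case: ifP => //; case: x => //= c; case: (reduce w) => //= y v /eqP[->].
  have -> : size (u ++ [:: Some c, Some c & v]) = (size (u ++ Some c :: v)).+1.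
    by rewrite !size_cat /= !addnS.
  exact: labelled_count_dup.
exact: (gen [::]).
Qed.

Lemma labelled_count_reduce2 (a b : nat) (w w' : seq label) :
  labelled_count a b (size w) (size w') w w' =
  labelled_count a b (size (reduce w)) (size (reduce w')) (reduce w) (reduce w').
Proof.
by rewrite labelled_count_reduce labelled_count_flip labelled_count_reduce labelled_count_flip.
Qed.

Lemma remainder_labelled (a b p q : nat) :
  remainder a b p.+1 q.+1 =
  \sum_(w : p.-tuple label) \sum_(w' : q.-tuple label) labelled_count a b p q w w'.
Proof.
set A := fset_set [set h | @remainder_height a b p.+1 q.+1 h]%classic.
have memA h : (h \in A) = remainder_height a b h.
  rewrite in_fset_set; last exact: finite_remainder_height.
  by apply/idP/idP; rewrite inE.
pose rw (h : {ffun cell p.+1 q.+1 -> int}) := row_word p q (vstep (nat_height h)).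
pose cw (h : {ffun cell p.+1 q.+1 -> int}) := col_word p q (hstep (nat_height h)).
have part w w' : labelled_count a b p q w w' = \sum_(h <- A) ((rw h == w) && (cw h == w')).
  rewrite /labelled_count card_fset_sum1.
  have -> : fset_set [set h : {ffun cell p.+1 q.+1 -> int} |
                 labelled_height a b p q w w' (nat_height h)]%classic =
            [fset h in A | (rw h == w) && (cw h == w')]%fset.
    apply/fsetP => h; rewrite in_fset_set; last exact: finite_labelled.
    rewrite !inE memA; apply/idP/idP.
      rewrite inE => -[h1 h2 e1 e2]; rewrite /rw /cw e1 e2 !eqxx !andbT.
      by apply/remainder_heightP.
    by move=> /and3P[/remainder_heightP[h1 h2] /eqP e1 /eqP e2]; rewrite inE.
  by rewrite -big_fset_condE big_mkcond; apply: eq_bigr => h _; case: (_ && _).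
rewrite /remainder -/A card_fset_sum1.
under [in RHS]eq_bigr => w _ do under eq_bigr => w' _ do rewrite part.
under [in RHS]eq_bigr => w _ do rewrite exchange_big.
rewrite [RHS]exchange_big; apply: eq_bigr => h _ /=.
have sr : size (rw h) == p by rewrite size_mkseq.
have sc : size (cw h) == q by rewrite size_mkseq.
rewrite (bigD1 (Tuple sr)) //= (bigD1 (Tuple sc)) //= !eqxx.
rewrite big1 => [|w']; last first.
  by move=> ne; case: eqP => // e; case/eqP: ne; apply: val_inj.
rewrite big1 // => w ne; rewrite big1 // => w' _.
by case: eqP => // e; case/eqP: ne; apply: val_inj.
Qed.

Lemma labelled_count_bound (a b : nat) (w w' : seq label) :
    a + b = 8 -> 0 < size w -> 0 < size w' -> reduced w -> reduced w' ->
    labelled_count a b (size w) (size w') w w' != 0 ->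
  [/\ count isSome w + count isSome w' <= 7, size w <= count isSome w + 7 &
      size w' <= count isSome w' + 7].
Proof.
move=> ab sw sw' rw rw'; rewrite cardfs_eq0 => /fset0Pn[h].
rewrite in_fset_set; last exact: finite_labelled.
rewrite inE => -[ho r e e'].
have := remainder_words_bound sw sw' ab (height_face_rule ho) r.
by rewrite e e'; apply.
Qed.

(** * Counting words and assembling the polynomial *)

Definition word_count (p : nat) (l : seq label) : nat :=
  \sum_(w : p.-tuple label) (reduce w == l).

Lemma sum_tuple_cons (p : nat) (f : seq label -> nat) :
  \sum_(w : p.+1.-tuple label) f w = \sum_(x : label) \sum_(w : p.-tuple label) f (x :: w).
Proof.
rewrite pair_bigA /= (reindex (fun u : label * p.-tuple label => [tuple of u.1 :: u.2])) //=.
exists (fun w => (thead w, [tuple of behead w])) => [[x w] _|w _] /=.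
  by rewrite theadE; congr (_, _); apply: val_inj.
by apply: val_inj; rewrite /= [in RHS](tuple_eta w).
Qed.

Lemma word_count0 (l : seq label) : word_count 0 l = (l == [::]).
Proof.
rewrite /word_count (bigD1 [tuple]) //= big1 => [|w /eqP[]]; last exact: tuple0.
by rewrite addn0 eq_sym.
Qed.

Lemma word_countS_nil (p : nat) : word_count p.+1 [::] = 0.
Proof.
rewrite /word_count (sum_tuple_cons p (fun w => nat_of_bool (reduce w == [::]))).
rewrite big1 // => x _; rewrite big1 // => w _ /=.
by case: ifP => // /andP[_]; case: (reduce w).
Qed.

Lemma word_countS_None (p : nat) (l : seq label) :
  word_count p.+1 (None :: l) = word_count p l.
Proof.
rewrite /word_count (sum_tuple_cons p (fun w => nat_of_bool (reduce w == None :: l))).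
rewrite (bigD1 None) //= [X in _ + X]big1 ?addn0.
  by apply: eq_bigr => w _; rewrite eqseq_cons eqxx.
case=> // c _; rewrite big1 // => w _ /=.
by case: ifP => //; case: (reduce w) => //= y v /eqP[->].
Qed.

(** The first letter either prolongs the first run or is the whole of it: this is the Pascal
    recursion. *)
Lemma word_countS_Some (p : nat) (c : bool) (l : seq label) : reduced (Some c :: l) ->
  word_count p.+1 (Some c :: l) = word_count p (Some c :: l) + word_count p l.
Proof.
move=> /= /andP[hl _].
rewrite /word_count (sum_tuple_cons p (fun w => nat_of_bool (reduce w == Some c :: l))).
rewrite (bigD1 (Some c)) //= [X in _ + X]big1 ?addn0.
  rewrite -big_split /=; apply: eq_bigr => w _; case: ifP => h.
    case: (reduce w =P l) => [e|_]; last by rewrite addn0.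
    by rewrite -e h in hl.
  case: (reduce w =P Some c :: l) => [e|_]; first by rewrite e /= eqxx in h.
  by rewrite eqseq_cons eqxx.
move=> x ne; rewrite big1 // => w _; case: ifP => [/andP[_]|_].
  case: (reduce w) => //= y v /eqP[->]; rewrite eqseq_cons.
  by case: eqP => // e; rewrite e eqxx in ne.
by rewrite eqseq_cons (negPf ne).
Qed.

(* Expanding a reduced word amounts to choosing the lengths of its straight
   runs, that is, a composition of the remaining length. *)
Lemma word_countE (p : nat) (l : seq label) : reduced l ->
  word_count p l =
    if count isSome l == 0 then nat_of_bool (p == size l)
    else if count (predC isSome) l < p then
      'C((p - count (predC isSome) l).-1, (count isSome l).-1)
    else 0.
Proof.
elim: p l => [|p IH] [|x l] rl; rewrite ?word_count0 ?word_countS_nil //.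
  by rewrite ltn0; case: ifP.
case: x rl => [c|] rl; last first.
  by rewrite word_countS_None IH.
rewrite word_countS_Some // (IH _ rl) IH; last by case/andP: rl.
rewrite /= !add0n; set z := count (predC isSome) l; set k := count isSome l.
have szl : size l = k + z by rewrite -(count_predC isSome).
rewrite ltnS szl; case: (posnP k) => [->|k0].
  by rewrite !bin0 add0n; case: ltngtP.
rewrite -(prednK k0) /=; case: ltngtP => // [h|->]; last by rewrite subSnn.
have -> : (p.+1 - z).-1 = (p - z).-1.+1 by clear -h; lia.
by rewrite binS.
Qed.

Lemma sum_reduce (p n : nat) (f : seq label -> nat) :
    (forall l, n < size l -> f l = 0) ->
  \sum_(w : p.-tuple label) f (reduce w) = \sum_(l : n.-bseq label) word_count p l * f l.
Proof.
move=> f0; under [RHS]eq_bigr => l _ do rewrite big_distrl /=.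
rewrite exchange_big; apply: eq_bigr => w _ /=.
case: (leqP (size (reduce w)) n) => [h|h].
  rewrite (bigD1 (Bseq h)) //= eqxx mul1n big1 ?addn0 // => l ne.
  by case: eqP => // e; case/eqP: ne; apply: val_inj.
rewrite f0 // big1 // => l _; case: eqP => // e.
by have := size_bseq l; rewrite -e leqNgt h.
Qed.

Definition reduced_count (a b : nat) (l l' : seq label) : nat :=
  if [&& reduced l, reduced l', 0 < size l & 0 < size l']
  then labelled_count a b (size l) (size l') l l' else 0.

Lemma size_reduce_gt0 (p : nat) (w : p.+1.-tuple label) : 0 < size (reduce w).
Proof. by rewrite (tuple_eta w) /=; case: ifP => // /andP[_]; case: (reduce _). Qed.

Lemma reduced_count_bound (a b : nat) (l l' : seq label) : a + b = 8 ->
    reduced_count a b l l' != 0 ->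
  [/\ reduced l, reduced l', count isSome l + count isSome l' <= 7 &
      size l <= count isSome l + 7 /\ size l' <= count isSome l' + 7].
Proof.
rewrite /reduced_count; case: ifP => // /and4P[r r' s s'] ab n0.
by have [] := labelled_count_bound ab s s' r r' n0; split.
Qed.

(** The length 14 is 7 straight bands plus at most 7 bands with saddles. Sides of at least two cells
    make all words nonempty, as the bounds require. *)
Lemma remainder_reduced (a b p q : nat) : a + b = 8 ->
  remainder a b p.+2 q.+2 =
  \sum_(l : 14.-bseq label) \sum_(l' : 14.-bseq label)
    word_count p.+1 l * word_count q.+1 l' * reduced_count a b l l'.
Proof.
move=> ab; rewrite remainder_labelled.
have long1 l l' : 14 < size l -> reduced_count a b l l' = 0.
  move=> h; apply/eqP/negPn/negP => /(reduced_count_bound ab)[_ _ h1 [h2 h3]].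
  by clear -h h1 h2 h3; lia.
have long2 l l' : 14 < size l' -> reduced_count a b l l' = 0.
  move=> h; apply/eqP/negPn/negP => /(reduced_count_bound ab)[_ _ h1 [h2 h3]].
  by clear -h h1 h2 h3; lia.
pose f l := \sum_(w' : q.+1.-tuple label) reduced_count a b l (reduce w').
transitivity (\sum_(w : p.+1.-tuple label) f (reduce w)).
  apply: eq_bigr => w _; apply: eq_bigr => w' _.
  rewrite /reduced_count !reduce_reduced !size_reduce_gt0 /= -labelled_count_reduce2.
  by rewrite !size_tuple.
rewrite (@sum_reduce _ 14 f); last by move=> l h; rewrite /f big1 // => i _; exact: long1.
apply: eq_bigr => l _; rewrite /f (@sum_reduce _ 14 (reduced_count a b l)) //; last exact: long2.
by rewrite big_distrr; apply: eq_bigr => l' _ /=; rewrite mulnA.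
Qed.

Local Open Scope ring_scope.

Lemma msizeM_leq (n d e : nat) (R : idomainType) (P Q : {mpoly R[n]}) :
  (msize P <= d.+1)%N -> (msize Q <= e.+1)%N -> (msize (P * Q) <= (d + e).+1)%N.
Proof.
have [->|P0] := eqVneq P 0; first by rewrite mul0r msize0.
have [->|Q0] := eqVneq Q 0; first by rewrite mulr0 msize0.
rewrite msizeM // => hP hQ; move: (leq_add hP hQ); rewrite addSn addnS.
by case: (_ + _)%N.
Qed.

(* For the variable m, this is the binomial coefficient C(m - 2 - z, k - 1). *)
Definition binomial_poly (i : 'I_2) (z k : nat) : {mpoly rat[2]} :=
  (k.-1`!)%:R^-1 *: \prod_(t < k.-1) ('X_i - (z + 2 + t)%:R%:MP).

Lemma binomial_poly_eval (v : 'I_2 -> rat) (i : 'I_2) (z k n : nat) :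
  v i = (n + z + 2)%:R -> (binomial_poly i z k).@[v] = 'C(n, k.-1)%:R.
Proof.
move=> vi; rewrite mevalZ rmorph_prod /=.
have -> : \prod_(t < k.-1) ('X_i - (z + 2 + t)%:R%:MP).@[v] = (n ^_ k.-1)%:R.
  elim: k.-1 => [|d IH]; first by rewrite big_ord0 ffactn0.
  rewrite big_ord_recr /= IH ffactnSr mevalB mevalXU mevalC vi.
  case: (leqP d n) => h; last by rewrite ffact_small // !mul0r.
  by rewrite natrM natrB // !natrD; congr (_ * _); ring.
rewrite -bin_ffact natrM mulrCA mulVf ?mulr1 //.
by rewrite pnatr_eq0 -lt0n fact_gt0.
Qed.

Lemma msize_binomial_poly (i : 'I_2) (z k : nat) :
  (msize (binomial_poly i z k) <= k.-1.+1)%N.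
Proof.
apply: leq_trans (msizeZ_le _ _) _.
elim: k.-1 => [|d IH]; first by rewrite big_ord0 msize1.
rewrite big_ord_recr /=; have -> : d.+2 = (d + 1).+1 by rewrite addn1.
apply: (msizeM_leq IH).
apply: leq_trans (msizeD_le _ _) _; rewrite msizeN msizeC geq_max msizeX mdeg1 /=.
by case: (_ != 0).
Qed.

Theorem corollary11p1 (a b : nat) (ha : (1 <= a)%N) (hab : (a <= b)%N)
    (hd : (a + b = 8)%N) :
  exists P : {mpoly rat[2]},
    agrees_from (2 * (a + b) - 1)%N (remainder a b) P /\
    (total_degree P <= 5)%N.
Proof.
pose ns (l : seq label) := count isSome l.
pose nz (l : seq label) := count (predC isSome) l.
(* A contributing reduced word without straight bands has length at most 7 and cannot be expanded,
   so it contributes nothing on grids in the stated range. *)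
pose term (l l' : seq label) : {mpoly rat[2]} :=
  if (0 < ns l)%N && (0 < ns l')%N then
    (reduced_count a b l l')%:R *:
      (binomial_poly ord0 (nz l) (ns l) * binomial_poly ord_max (nz l') (ns l'))
  else 0.
exists (\sum_(l : 14.-bseq label) \sum_(l' : 14.-bseq label) term l l'); split.
  (* Sides of at least 15 cells have at least 14 bands, more than the 7 bands with saddles, so
     [word_count] is given by its binomial branch. *)
  rewrite hd => -[|[|p]] // [|[|q]] // p14 q14.
  rewrite remainder_reduced // natr_sum /eval2 rmorph_sum; apply: eq_bigr => l _.
  rewrite natr_sum rmorph_sum; apply: eq_bigr => l' _ /=.
  rewrite /term; case: (reduced_count a b l l' =P 0%N) => [->|/eqP n0].
    by rewrite muln0 mulr0n scale0r; case: ifP => _; rewrite meval0.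
  have [r r' _ [s s']] := reduced_count_bound hd n0.
  rewrite -/(ns l) in s; rewrite -/(ns l') in s'.
  have sz (w : seq label) : size w = (ns w + nz w)%N by rewrite -(count_predC isSome).
  rewrite !word_countE // -/(ns l) -/(ns l') -/(nz l) -/(nz l').
  case: (posnP (ns l)) => [k0|k0] /=.
    have -> : (p.+1 == size l) = false.
      by apply/eqP => e; move: p14 s; rewrite k0 -e; clear; lia.
    by rewrite !mul0n meval0.
  case: (posnP (ns l')) => [k0'|k0'] /=.
    have -> : (q.+1 == size l') = false.
      by apply/eqP => e; move: q14 s'; rewrite k0' -e; clear; lia.
    by rewrite muln0 mul0n meval0.
  have zp : (nz l < p.+1)%N by move: p14 s; rewrite sz; move: (ns l) (nz l); clear; lia.
  have zq : (nz l' < q.+1)%N by move: q14 s'; rewrite sz; move: (ns l') (nz l'); clear; lia.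
  rewrite zp zq !natrM mulrC mevalZ mevalM; congr (_ * (_ * _)).
    apply/esym/binomial_poly_eval; rewrite (tnth_nth 0) /=; congr (_%:R).
    by move: zp; move: (nz l); clear; lia.
  apply/esym/binomial_poly_eval; rewrite (tnth_nth 0) /=; congr (_%:R).
  by move: zq; move: (nz l'); clear; lia.
(* Each term has degree at most [(ns l - 1) + (ns l' - 1) <= 7 - 2], and [msize] exceeds the degree
   by one. *)
have small : (msize (\sum_(l : 14.-bseq label) \sum_(l' : 14.-bseq label) term l l') <= 6)%N.
  apply: leq_trans (msize_sum _ _ _) _; apply/bigmax_leqP => l _.
  apply: leq_trans (msize_sum _ _ _) _; apply/bigmax_leqP => l' _.
  rewrite /term; case: (reduced_count a b l l' =P 0%N) => [->|/eqP n0].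
    by rewrite scale0r; case: ifP; rewrite msize0.
  have [_ _ kk _] := reduced_count_bound hd n0.
  case: ifP => [/andP[k1 k2]|_]; last by rewrite msize0.
  apply: leq_trans (msizeZ_le _ _) _; 
  apply: leq_trans (msizeM_leq (msize_binomial_poly _ _ _) (msize_binomial_poly _ _ _)) _.
  by move: kk k1 k2; rewrite -/(ns l) -/(ns l'); move: (ns l) (ns l'); clear; lia.
by move: small; rewrite /total_degree; case: (mmeasure _ _).
Qed.
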